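(* Let $\rho_{A_1A_2\cdots A_n}$ be an $n$-qubit state, and let $k\geq 1$, $\frac12\leq p\leq 1$, $r\geq 2$, $0\leq\alpha\leq\frac r2$. Put $l=\frac{(1+k)^{\alpha/r}-p^{\alpha/r}}{k^{\alpha/r}}$. Write $C_{A_1A_i}=C(\rho_{A_1A_i})$ for $i=2,\dots,n$ and $C_{A_1|A_{j+1}\cdots A_n}=C(\rho_{A_1|A_{j+1}\cdots A_n})$ for $j=1,\dots,n-1$ (so $C_{A_1|A_n}=C_{A_1A_n}$). (1) Let $n\geq 4$ and $2\leq m\leq n-2$. If $k\,C^r_{A_1A_i}\leq C^r_{A_1|A_{i+1}\cdots A_n}$ for $i=2,\dots,m$ and $C^r_{A_1A_j}\geq k\,C^r_{A_1|A_{j+1}\cdots A_n}$ for $j=m+1,\dots,n-1$, then $$C^\alpha_{A_1|A_2\cdots A_n}\geq p^{\alpha/r}\big(C^\alpha_{A_1A_2}+lC^\alpha_{A_1A_3}+\cdots+l^{m-2}C^\alpha_{A_1A_m}\big)+l^m\big[C^\alpha_{A_1A_{m+1}}+p^{\alpha/r}C^\alpha_{A_1A_{m+2}}+\cdots+p^{(n-m-2)\alpha/r}C^\alpha_{A_1A_{n-1}}\big]+l^{m-1}p^{(n-m-1)\alpha/r}C^\alpha_{A_1A_n}.$$ (2) Let $n\geq 3$. If $k\,C^r_{A_1A_i}\leq C^r_{A_1|A_{i+1}\cdots A_n}$ for $i=2,\dots,n-1$, then $$C^\alpha_{A_1|A_2\cdots A_n}\geq p^{\alpha/r}\big(C^\alpha_{A_1A_2}+lC^\alpha_{A_1A_3}+\cdots+l^{n-3}C^\alpha_{A_1A_{n-1}}\big)+l^{n-2}C^\alpha_{A_1A_n}.$$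 (3) Let $n\geq 3$. If $C^r_{A_1A_j}\geq k\,C^r_{A_1|A_{j+1}\cdots A_n}$ for $j=2,\dots,n-1$, then $$C^\alpha_{A_1|A_2\cdots A_n}\geq l\big(C^\alpha_{A_1A_2}+p^{\alpha/r}C^\alpha_{A_1A_3}+\cdots+p^{(n-3)\alpha/r}C^\alpha_{A_1A_{n-1}}\big)+p^{(n-2)\alpha/r}C^\alpha_{A_1A_n}.$$
   Context: For a bipartite pure state $|\varphi\rangle_{XY}$, its concurrence is $C(|\varphi\rangle)=\sqrt{2[1-\mathrm{tr}(\rho_X^2)]}$ with $\rho_X=\mathrm{tr}_Y|\varphi\rangle\langle\varphi|$; for a mixed bipartite state, $C(\rho_{XY})=\min\sum_ip_iC(|\varphi_i\rangle)$ over all pure-state ensembles $\{p_i,|\varphi_i\rangle\}$ of $\rho_{XY}$. For the $n$-qubit state $\rho=\rho_{A_1\cdots A_n}$, $\rho_{A_1A_i}$ is the reduced state on $A_1A_i$ (partial trace over all other qubits), $\rho_{A_1|A_{j+1}\cdots A_n}$ is the reduced state on $A_1A_{j+1}\cdots A_n$ regarded as a bipartite state for the bipartition $A_1$ versus $A_{j+1}\cdots A_n$, and $C^\alpha$ denotes the $\alpha$-th power of concurrence. *)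

(* Defs.v *)
From mathcomp Require Import all_boot all_order all_algebra.
From mathcomp Require Import classical_sets reals exp.
From mathcomp Require Import complex.

Set Implicit Arguments.
Unset Strict Implicit.
Unset Printing Implicit Defensive.

Import Order.TTheory GRing.Theory Num.Theory.
Local Open Scope ring_scope.

Section Quantum.
Variable R : realType.
Local Notation C := R[i].

(* Computational basis configurations of a finite family I of qubits. *)
Definition cfg (I : finType) := {ffun I -> bool}.

(* Operators (matrices) on the Hilbert space with orthonormal basis T. *)
Definition op (T : finType) := T -> T -> C.

Definition trace (T : finType) (A : op T) : C := \sum_(a : T) A a a.
Definition opmul (T : finType) (A B : op T) : op T :=
  fun a b => \sum_(c : T) A a c * B c b.

Definition psd (T : finType) (A : op T) : Prop :=
  forall v : T -> C, 0 <= \sum_(a : T) \sum_(b : T) Num.conj (v a) * A a b * v b.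

Definition is_state (T : finType) (rho : op T) : Prop :=
  psd rho /\ trace rho = 1.

Definition normalized (T : finType) (phi : T -> C) : Prop :=
  \sum_(a : T) `|phi a| ^+ 2 = 1.

Definition proj (T : finType) (phi : T -> C) : op T :=
  fun a b => phi a * Num.conj (phi b).

Definition cjoin (I : finType) (P : pred I)
  (a : cfg {x : I | P x}) (c : cfg {x : I | ~~ P x}) : cfg I :=
  [ffun x => match (insub x : option {x : I | P x}) with
             | Some s => a s
             | None => match (insub x : option {x : I | ~~ P x}) with
                       | Some t => c t
                       | None => false
                       end
             end].

Definition ptrace (I : finType) (P : pred I) (rho : op (cfg I))
  : op (cfg {x : I | P x}) :=
  fun a b => \sum_(c : cfg {x : I | ~~ P x}) rho (cjoin a c) (cjoin b c).

Arguments ptrace {I} P rho.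

Definition pure_conc (I : finType) (Q : pred I) (phi : cfg I -> C) : R :=
  let rQ := ptrace Q (proj phi) in
  Num.sqrt (2 * (1 - complex.Re (trace (opmul rQ rQ)))).

Definition ensemble_of (I : finType) (rho : op (cfg I)) (m : nat)
  (pr : 'I_m -> R) (phi : 'I_m -> cfg I -> C) : Prop :=
  [/\ forall i, 0 <= pr i,
      \sum_(i < m) pr i = 1,
      forall i, normalized (phi i) &
      forall a b, rho a b = \sum_(i < m) ((pr i)%:C)%C * proj (phi i) a b].

(* concurrence of a mixed state: convex roof (min = inf over all ensembles) *)
Definition conc (I : finType) (Q : pred I) (rho : op (cfg I)) : R :=
  inf [set x : R | exists m (pr : 'I_m -> R) (phi : 'I_m -> cfg I -> C),
         ensemble_of rho pr phi /\ x = \sum_(i < m) pr i * pure_conc Q (phi i)].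

(* Qubits A_1, ..., A_n are the ordinals 0, ..., n-1 of 'I_n (A_i = i-1). *)
Definition sysA1Ai (n i : nat) : pred 'I_n :=
  [pred x : 'I_n | (nat_of_ord x == 0%N) || (nat_of_ord x == i.-1)].
Definition sysA1tail (n j : nat) : pred 'I_n :=
  [pred x : 'I_n | (nat_of_ord x == 0%N) || (j <= nat_of_ord x)%N].
Arguments sysA1Ai : clear implicits.
Arguments sysA1tail : clear implicits.
Definition partA1 (n : nat) (P : pred 'I_n) : pred {x : 'I_n | P x} :=
  [pred y | nat_of_ord (val y) == 0%N].

Arguments partA1 {n} P.

Definition C_A1A (n : nat) (rho : op (cfg 'I_n)) (i : nat) : R :=
  conc (partA1 (sysA1Ai n i)) (ptrace (sysA1Ai n i) rho).
Definition C_A1tail (n : nat) (rho : op (cfg 'I_n)) (j : nat) : R :=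
  conc (partA1 (sysA1tail n j)) (ptrace (sysA1tail n j) rho).

End Quantum.

(* Main.v *)
(** The scalar content is a monotonicity: with [x = alpha / r <= 1/2], the
    ratio [((1 + t)^x - p^x) / t^x] is nondecreasing for [t >= 1], by concavity
    of the power. Applied along the chain of tails, it reduces the theorem to
    the monogamy inequality C(A|BC)^2 >= C(A|B)^2 + C(A|C)^2 for a qubit [A], a
    qubit [B] and an arbitrary system [C].

    For a pure state, write the amplitudes as a family [M_h] of 2x2 matrices,
    with rows indexed by [A], columns by [B], and [h] running over [C]. Then
    C(A|BC)^2 = 4 det E(1), where [E(X) = sum_h M_h X M_h^dag]. A decomposition
    of the state of [AB] is an isometric mixing of the [M_h], of concurrence the
    sum of the [2 |det|]; a decomposition of the state of [AC] is a measurement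
    of [B]. Measuring [B] along a traceless Hermitian [n] with [det n = -1] has
    squared concurrence at most 4 det E(1) + 4 det E(n).
    By Takagi factorisation the [M_h] become orthogonal for the polarised
    determinant; hence they are [A m_h L] with every [m_h] diagonal or
    antidiagonal, and one can pick [n] with [L n L^dag] antidiagonal. For this
    [n], suitable phases yield a decomposition of [AB] of squared concurrence
    exactly [- 4 det E(n)], and the two contributions add up to at most
    4 det E(1). Mixed states follow by Minkowski's inequality. *)
Require Import Defs.
From mathcomp Require Import all_boot all_order all_algebra.
From mathcomp Require Import spectral.
From mathcomp Require Import classical_sets reals exp.
From mathcomp Require Import complex.
From mathcomp Require Import ring lra zify.
Import Order.TTheory GRing.Theory Num.Theory.
Local Open Scope ring_scope.

Set Implicit Arguments.
Unset Strict Implicit.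
Unset Printing Implicit Defensive.

(** * Takagi factorisation: unitary congruence diagonalises complex symmetric matrices *)

Section Takagi.
Variable C : numClosedFieldType.
Local Notation cj := (map_mx (@Num.conj C)).

Lemma mulmx_conjtr_ge0 n (u : 'rV[C]_n) : 0 <= (u *m cj u^T) 0 0.
Proof. by rewrite mxE sumr_ge0 // => i _; rewrite !mxE mul_conjC_ge0. Qed.

Lemma mulmx_conjtr_gt0 n (u : 'rV[C]_n) : u != 0 -> 0 < (u *m cj u^T) 0 0.
Proof.
move=> /eqP u0; rewrite lt_neqAle mulmx_conjtr_ge0 andbT eq_sym mxE.
apply/negP => /eqP /psumr_eq0P H; apply: u0; apply/rowP => i.
have /H : forall i, true -> 0 <= u 0 i * (cj u^T) i 0.
  by move=> j _; rewrite !mxE mul_conjC_ge0.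
move=> /(_ i isT) /eqP; rewrite !mxE mul_conjC_eq0 => /eqP.
by [].
Qed.

(* For symmetric [T] the antilinear map [v |-> conj (v T)] has positive square
   [v |-> v T conj T], so an eigenvector [v] of the square with eigenvalue
   [s ^+ 2] yields [conj (v T) + s v], an eigenvector of the map itself. *)
Lemma coneigenvector n (T : 'M[C]_n.+1) : T^T = T ->
  exists2 u : 'rV_n.+1, u != 0 & exists s, u *m T = s *: cj u.
Proof.
move=> sT; have [mu /eigenvalueP[v vE v0]] := eigenvalue_closed (T *m cj T) isT.
(* Pairing the eigenvalue equation with [v] and using the symmetry of [T] gives mu |v|^2 = |v
   T|^2. *)
have mu_ge0 : 0 <= mu.
  have /(congr1 (fun w => (w *m cj v^T) 0 0)) := vE.
  rewrite -scalemxAl [in RHS]mxE mulmxA -(mulmxA (v *m T)).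
  have -> : cj T *m cj v^T = cj (v *m T)^T by rewrite -map_mxM -{1}sT -trmx_mul.
  move=> E; rewrite -(pmulr_lge0 _ (mulmx_conjtr_gt0 v0)) -E.
  exact: mulmx_conjtr_ge0.
pose s := sqrtC mu; have s2 : s * s = mu by rewrite -expr2 sqrtCK.
have sR : s^* = s by apply: geC0_conj; rewrite sqrtC_ge0.
have [w0|w0] := eqVneq (cj (v *m T) + s *: v) 0; last first.
  exists (cj (v *m T) + s *: v) => //; exists s.
  have vv : cj (v *m T) *m T = mu *: cj v.
    rewrite -[X in _ *m X]map_mxCK -map_mxM -mulmxA vE map_mxZ.
    by congr (_ *: _); apply: geC0_conj.
  rewrite mulmxDl vv -scalemxAl map_mxD map_mxZ /= sR map_mxCK.
  by rewrite scalerDr scalerA s2 addrC.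
(* The candidate vector vanishes, which says that [v] itself is a solution, with coefficient
   [- s]. *)
exists v => //; exists (- s).
have : cj (v *m T) = - s *: v by apply/eqP; rewrite scaleNr -addr_eq0 w0.
by move=> /(congr1 cj); rewrite map_mxZ rmorphN /= sR map_mxCK => ->.
Qed.

(** Gram-Schmidt is run on the matrix all of whose rows are [u]: the output is unitary even on this
    rank-one input, and its first row spans the line of [u]. *)
Lemma unitary_first_row n (u : 'rV[C]_n.+1) : u != 0 ->
  exists2 V : 'M_n.+1, V \is unitarymx & exists2 c, c != 0 & row 0 V = c *: u.
Proof.
move=> u0; pose A : 'M[C]_n.+1 := \matrix_(i, j) u 0 j.
exists (schmidt A); first exact: schmidt_unitarymx.
have := row_schmidt_sub A 0; rewrite (big_pred1 0); last first.
  by move=> i /=; rewrite leqn0.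
rewrite genmxE => /sub_rVP[c]; have -> : row 0 A = u.
  by apply/rowP => j; rewrite !mxE.
move=> uE; have c0 : c != 0 by apply: contraNneq u0 => c0; rewrite uE c0 scale0r.
by exists c^-1; rewrite ?invr_eq0 // uE scalerA mulVf // scale1r.
Qed.

(** Induction on the size. With a unit multiple of an eigenvector of the antilinear map as first row
    of [V], the first row of [V *m T *m V^T] is a multiple of the first basis vector; symmetry
    clears the first column, and a smaller symmetric block remains. *)
Lemma takagi n (T : 'M[C]_n) : T^T = T ->
  exists2 V : 'M_n, V \is unitarymx & is_diag_mx (V *m T *m V^T).
Proof.
elim: n T => [|n IHn] T sT.
  exists 1%:M; last by apply/is_diag_mxP => -[].
  by apply/unitarymxP; rewrite trmx1 map_mx1 mulmx1.
have [u u0 [s uE]] := coneigenvector sT.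
have [V Vu [c c0 VE]] := unitary_first_row u0.
have [d dE] : exists d, row 0 V *m T = d *: cj (row 0 V).
  exists (c * s / c^*); rewrite VE -scalemxAl uE map_mxZ !scalerA.
  by rewrite divfK // conjC_eq0.
have [T' VTV] : exists T', T' = V *m T *m V^T by exists (V *m T *m V^T).
have sT' : T'^T = T' by rewrite VTV !trmx_mul trmxK sT mulmxA.
have T'0 j : T' 0 j = d *+ (j == 0).
  have -> : T' 0 j = (row 0 V *m T *m V^T) 0 j.
    by rewrite VTV -!row_mul [in RHS]mxE.
  rewrite dE -scalemxAl -[V^T]map_mxCK -map_mxM -row_mul (unitarymxP Vu).
  by rewrite !mxE eq_sym rmorph_nat mulr_natr.
pose T1 : 'M_n := @drsubmx _ 1 n 1 n T'.
have T'E : T' = @block_mx _ 1 n 1 n d%:M 0 0 T1.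
  rewrite -[LHS](@submxK _ 1 n 1 n); congr (@block_mx _ 1 n 1 n _ _ _ _).
  - by apply/matrixP=> i j; rewrite !ord1 !mxE -(T'0 0); congr (T' _ _); apply/val_inj.
  - apply/matrixP=> i j; have <- : T' 0 (lift 0 j) = (0 : 'M_(1, n)) i j.
      by rewrite T'0 mxE.
    rewrite !mxE.
    by congr (T' _ _); apply/val_inj => /=; rewrite ?ord1.
  - apply/matrixP=> i j; have <- : T' 0 (lift 0 i) = (0 : 'M_(n, 1)) i j.
      by rewrite T'0 mxE.
    rewrite -[in LHS]sT' !mxE.
    by congr (T' _ _); apply/val_inj => /=; rewrite ?ord1.
have sT1 : T1^T = T1.
  by apply/matrixP => i j; rewrite mxE /T1 !mxE -[in LHS]sT' mxE.
have [V1 V1u V1d] := IHn _ sT1.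
pose B : 'M_n.+1 := @block_mx _ 1 n 1 n 1%:M 0 0 V1.
have Bu : B \is unitarymx.
  apply/unitarymxP.
  rewrite /B (@tr_block_mx _ 1 n 1 n) (@map_block_mx _ _ _ 1 n 1 n).
  rewrite (@mulmx_block _ 1 n 1 n 1 n).
  rewrite !trmx0 !map_mx0 trmx1 map_mx1 !mul1mx !mulmx0 !mul0mx addr0 !add0r.
  by rewrite (unitarymxP V1u) -scalar_mx_block.
exists (B *m V); first exact: mul_unitarymx.
have -> : B *m V *m T *m (B *m V)^T = B *m T' *m B^T.
  by rewrite VTV trmx_mul !mulmxA.
rewrite T'E /B (@tr_block_mx _ 1 n 1 n) !(@mulmx_block _ 1 n 1 n 1 n).
rewrite !trmx0 trmx1.
rewrite !mul1mx !mulmx0 !mul0mx !addr0 !add0r mulmx1.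
by rewrite (@is_diag_block_mx _ 1 n 1 n) // V1d scalar_mx_is_diag !mul0mx !eqxx.
Qed.

End Takagi.

(** * The determinant of 2x2 matrices as a quadratic form, and normal forms of orthogonal
    families *)

Section TwoByTwo.
Variable C : numClosedFieldType.
Local Notation dag M := (map_mx (@Num.conj C) M^T).
Implicit Types X Y : 'M[C]_2.

(** The symmetric bilinear form obtained by polarising the determinant; the orthogonality of
    families of matrices is meant for this form. *)
Definition polar X Y : C :=
  X 0 0 * Y 1 1 + X 1 1 * Y 0 0 - X 0 1 * Y 1 0 - X 1 0 * Y 0 1.

Lemma det2E X : \det X = X 0 0 * X 1 1 - X 0 1 * X 1 0.
Proof.
rewrite (expand_det_row _ 0) !big_ord_recl big_ord0 addr0 /cofactor /= !addn0.
rewrite !det_mx11 !mxE /= expr0 mul1r expr1 mulN1r mulrN.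
by congr (_ * X _ _ - X _ _ * X _ _); apply/val_inj.
Qed.

Lemma mulmx2E X Y i j : (X *m Y) i j = X i 0 * Y 0 j + X i 1 * Y 1 j.
Proof.
by rewrite mxE !big_ord_recl big_ord0 addr0; congr (_ + X _ _ * Y _ _); apply/val_inj.
Qed.

Lemma matrix2P X Y : X 0 0 = Y 0 0 -> X 0 1 = Y 0 1 -> X 1 0 = Y 1 0 ->
  X 1 1 = Y 1 1 -> X = Y.
Proof.
have o2 (i : 'I_2) : i = 0 \/ i = 1.
  by case: i => -[|[|//]] ?; [left|right]; apply/val_inj.
by move=> *; apply/matrixP => i j; case: (o2 i) => ->; case: (o2 j) => ->.
Qed.

Lemma polar_det X Y : polar X Y = \det (X + Y) - \det X - \det Y.
Proof. by rewrite !det2E !mxE /polar; ring. Qed.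

Lemma polarxx X : polar X X = 2 * \det X.
Proof. by rewrite det2E /polar; ring. Qed.

Lemma polarC X Y : polar X Y = polar Y X.
Proof. by rewrite /polar; ring. Qed.

Lemma polar1l X : polar 1%:M X = X 0 0 + X 1 1.
Proof. by rewrite /polar !mxE /=; ring. Qed.

Lemma polarM A X Y B :
  polar (A *m X *m B) (A *m Y *m B) = \det A * \det B * polar X Y.
Proof. by rewrite !polar_det -mulmxDl -mulmxDr !det_mulmx; ring. Qed.

Lemma polar_suml (I : finType) (c : I -> C) (F : I -> 'M_2) Y :
  polar (\sum_i c i *: F i) Y = \sum_i c i * polar (F i) Y.
Proof.
rewrite /polar !summxE !mulr_suml -!sumrN -!big_split /=.
by apply: eq_bigr => i _; rewrite !mxE; ring.
Qed.

Lemma polar_sumr (I : finType) (c : I -> C) (F : I -> 'M_2) X :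
  polar X (\sum_i c i *: F i) = \sum_i c i * polar X (F i).
Proof.
by rewrite polarC polar_suml; apply: eq_bigr => i _; rewrite polarC.
Qed.

Lemma det_orthogonal_sum (I : finType) (c : I -> C) (F : I -> 'M_2) :
    (forall i j, i != j -> polar (F i) (F j) = 0) ->
  \det (\sum_i c i *: F i) = \sum_i c i ^+ 2 * \det (F i).
Proof.
move=> orth; apply: (@mulfI _ 2); first by rewrite pnatr_eq0.
rewrite -polarxx polar_suml mulr_sumr; apply: eq_bigr => i _.
rewrite polar_sumr (bigD1 i) //= big1 ?addr0 ?polarxx; first by ring.
by move=> j ji; rewrite orth ?mulr0 // eq_sym.
Qed.

Definition mx2 (a b c d : C) : 'M[C]_2 :=
  \matrix_(i, j) if i == 0 then if j == 0 then a else b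
                 else if j == 0 then c else d.

Lemma mx2E a b c d : ((mx2 a b c d 0 0 = a) * (mx2 a b c d 0 1 = b) *
  (mx2 a b c d 1 0 = c) * (mx2 a b c d 1 1 = d))%type.
Proof. by rewrite !mxE. Qed.

Lemma mx2_unit a b c d : a * d - b * c != 0 -> mx2 a b c d \in unitmx.
Proof. by move=> h; rewrite unitmxE unitfE det2E !mx2E. Qed.

(* The rows of [S] are left eigenvectors, or a Jordan chain. *)
Lemma traceless_normal_form (N : 'M[C]_2) : N != 0 -> N 0 0 + N 1 1 = 0 ->
  exists2 S : 'M[C]_2, S \in unitmx & exists K : 'M[C]_2,
    [/\ S *m N = K *m S, K 0 0 = - K 1 1, K 1 0 = 0 &
        (K 0 1 = 0 /\ K 1 1 != 0) \/ (K 0 1 != 0 /\ K 1 1 = 0)].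
Proof.
move=> N0 trN; pose mu := sqrtC (- \det N).
have trN' : N 1 1 = - N 0 0 by apply/eqP; rewrite -addr_eq0 addrC trN.
have mu2 : mu ^+ 2 = N 0 0 ^+ 2 + N 0 1 * N 1 0.
  by rewrite sqrtCK det2E trN'; ring.
have [a N00] : exists a, N 0 0 = a by exists (N 0 0).
have [b N01] : exists b, N 0 1 = b by exists (N 0 1).
have [c N10] : exists c, N 1 0 = c by exists (N 1 0).
have N11 : N 1 1 = - a by rewrite trN' N00.
rewrite N00 N01 N10 in mu2.
have NE : N = mx2 a b c (- a) by apply: matrix2P; rewrite mx2E.
have two0 : (2 : C) != 0 by rewrite pnatr_eq0.
(* Zero determinant makes [N] nilpotent: the rows of [S] are [v] and [v N], with [v] a basis vector
   such that [v N] is nonzero. *)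
have [mu0|mu0] := eqVneq mu 0.
  have {}mu2 : b * c = - a ^+ 2.
    by apply/eqP; rewrite -addr_eq0 addrC -mu2 mu0 expr0n.
  have [b0|b0] := eqVneq b 0.
    have a0 : a = 0.
      by apply/eqP; rewrite -sqrf_eq0 -oppr_eq0 -mu2 b0 mul0r.
    have c0 : c != 0.
      apply: contraNneq N0 => c0; rewrite NE a0 b0 c0; apply/eqP.
      by apply: matrix2P; rewrite mx2E mxE ?oppr0.
    exists (mx2 0 1 c 0); first by rewrite mx2_unit // mul0r mul1r sub0r oppr_eq0.
    exists (mx2 0 1 0 0); rewrite !mx2E oppr0 oner_eq0; split => //; last by right.
    by rewrite NE a0 b0; apply: matrix2P; rewrite !mulmx2E !mx2E; ring.
  exists (mx2 1 0 a b); first by rewrite mx2_unit // mul1r mul0r subr0.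
  exists (mx2 0 1 0 0); rewrite !mx2E oppr0 oner_eq0; split => //; last by right.
  by rewrite NE; apply: matrix2P; rewrite !mulmx2E !mx2E ?mu2; ring.
have K0 : mx2 mu 0 0 (- mu) 0 1 = 0 /\ mx2 mu 0 0 (- mu) 1 1 != 0.
  by rewrite !mx2E oppr_eq0.
(* The eigenvalues [mu] and [- mu] are distinct. A nonzero off-diagonal entry of [N] provides
   explicit eigenvectors; if there is none, [N] is already diagonal. *)
have [b0|b0] := eqVneq b 0; last first.
  exists (mx2 (a + mu) b (a - mu) b).
    rewrite mx2_unit //.
    have -> : (a + mu) * b - b * (a - mu) = 2 * mu * b by ring.
    by rewrite !mulf_neq0.
  exists (mx2 mu 0 0 (- mu)); split; [|by rewrite !mx2E opprK|by rewrite !mx2E|by left].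
  rewrite NE; apply: matrix2P; rewrite !mulmx2E !mx2E; try by ring.
    have -> : b * c = mu ^+ 2 - a ^+ 2 by rewrite mu2; ring.
    by ring.
  have -> : b * c = mu ^+ 2 - a ^+ 2 by rewrite mu2; ring.
  by ring.
have [c0|c0] := eqVneq c 0; last first.
  exists (mx2 c (mu - a) c (- mu - a)).
    rewrite mx2_unit //.
    have -> : c * (- mu - a) - (mu - a) * c = - (2 * mu * c) by ring.
    by rewrite oppr_eq0 !mulf_neq0.
  exists (mx2 mu 0 0 (- mu)); split; [|by rewrite !mx2E opprK|by rewrite !mx2E|by left].
  have a2 : a ^+ 2 = mu ^+ 2 by rewrite mu2 b0 mul0r addr0.
  rewrite NE b0; apply: matrix2P; rewrite !mulmx2E !mx2E; try by ring.
    by transitivity (a ^+ 2 - a * mu); [|rewrite a2]; ring.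
  by transitivity (a ^+ 2 + a * mu); [|rewrite a2]; ring.
exists 1%:M; first exact: unitmx1.
exists N; split; rewrite ?mulmx1 ?mul1mx ?N11 ?opprK ?N10 ?c0 //.
left; rewrite N01 b0 oppr_eq0; split=> //.
by apply: contraNneq mu0 => a0; rewrite -sqrf_eq0 mu2 a0 b0 mul0r addr0 expr0n.
Qed.

Definition diag_or_antidiag X :=
  (X 0 1 = 0 /\ X 1 0 = 0) \/ (X 0 0 = 0 /\ X 1 1 = 0).

(** Dividing by [F i0] turns that member into the identity and the others into traceless matrices,
    since [polar] against the identity is the trace. Conjugating one of them to normal form then
    constrains the rest by orthogonality. *)
Lemma orthogonal_family_normal_form (I : finType) (F : I -> 'M[C]_2) i0 :
    (forall i j, i != j -> polar (F i) (F j) = 0) -> \det (F i0) != 0 ->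
  exists A L (m : I -> 'M[C]_2),
    [/\ L \in unitmx, forall i, F i = A *m m i *m L &
        forall i, diag_or_antidiag (m i)].
Proof.
move=> orth d0; pose B := F i0; have Bu : B \in unitmx by rewrite unitmxE unitfE.
have [N Ndef] : exists N, forall i, N i = invmx B *m F i.
  by exists (fun i => invmx B *m F i).
have FE i : F i = B *m N i by rewrite Ndef mulKVmx.
have N0 : N i0 = 1%:M by rewrite Ndef mulVmx.
have dV : \det (invmx B) != 0 by rewrite det_inv invr_eq0.
have orthN i j : i != j -> polar (N i) (N j) = 0.
  move=> /orth E; rewrite -[N i]mulmx1 -[N j]mulmx1.
  by rewrite !Ndef polarM E mulr0.
have trN i : i != i0 -> N i 0 0 + N i 1 1 = 0.
  by rewrite eq_sym => /orthN; rewrite N0 polar1l.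
have [/forallP allz|allz0] := boolP [forall i, (i != i0) ==> (N i == 0)].
  exists B, 1%:M, N; split=> [||i]; [exact: unitmx1|by move=> i; rewrite mulmx1|].
  left; have [->|ni] := eqVneq i i0; first by rewrite N0 !mxE.
  by have /implyP/(_ ni)/eqP-> := allz i; rewrite !mxE.
(* The pivot [j] is taken invertible if possible; a singular pivot thus means that all members other
   than [i0] are singular. *)
have /existsP[j /and3P[ji0 Nj0 /orP dj]] : [exists j, [&& j != i0, N j != 0 &
    (\det (N j) != 0) || [forall i, (i != i0) ==> (\det (N i) == 0)]]].
  have [alld0|] := boolP [forall i, (i != i0) ==> (\det (N i) == 0)].
    move: allz0; rewrite negb_forall => /existsP[j].
    by rewrite negb_imply => /andP[ji0 Nj0]; apply/existsP; exists j;
      rewrite ji0 Nj0 orbT.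
  rewrite negb_forall => /existsP[j]; rewrite negb_imply => /andP[ji0 dj].
  apply/existsP; exists j; rewrite ji0 dj /= andbT.
  by apply: contraNneq dj => ->; rewrite det0.
have [S Su [K [SN K00 K10 Kcase]]] := traceless_normal_form Nj0 (trN j ji0).
pose m i := S *m N i *m invmx S.
have NE i : N i = invmx S *m m i *m S.
  by rewrite /m !mulmxA mulVmx // mul1mx mulmxKV.
have detm i : \det (m i) = \det (N i).
  rewrite /m !det_mulmx det_inv mulrAC mulfV ?mul1r //.
  by rewrite -unitfE -unitmxE.
have mj : m j = K by rewrite /m SN mulmxK.
have m0 : m i0 = 1%:M by rewrite /m N0 mulmx1 mulmxV.
have orthm i k : i != k -> polar (m i) (m k) = 0.
  by move=> /orthN E; rewrite polarM E mulr0.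
have trm i : i != i0 -> m i 0 0 + m i 1 1 = 0.
  by rewrite eq_sym => /orthm; rewrite m0 polar1l.
exists (B *m invmx S), S, m; split=> // i.
  by rewrite FE NE !mulmxA.
have [->|ni0] := eqVneq i i0; first by left; rewrite m0 !mxE.
have mi11 : m i 1 1 = - m i 0 0 by apply/eqP; rewrite -addr_eq0 addrC trm.
have [->|nij] := eqVneq i j.
  rewrite mj; case: Kcase => -[K01 K11]; first by left.
  by right; rewrite K00 K11 oppr0.
have := orthm j i; rewrite eq_sym nij mj => /(_ isT) H.
(* Orthogonality to a diagonal [K] kills the diagonal of [m i]. Orthogonality to a nilpotent [K]
   kills its lower left entry, and the singularity ensured by the choice of [j] then kills its
   diagonal. *)
right; move: H; case: Kcase => -[K01 K11].
  rewrite /polar K01 K10 K00 mi11 !mul0r !subr0 mulrNN -mulr2n => /eqP.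
  by rewrite mulrn_eq0 mulf_eq0 (negPf K11) /= => /eqP->; rewrite oppr0.
rewrite /polar K00 K10 K11 oppr0 !mul0r addr0 subr0 sub0r => /eqP.
rewrite oppr_eq0 mulf_eq0 (negPf K01) /= => /eqP mi10.
have dN0 : \det (N j) = 0.
  by rewrite -detm mj det2E K00 K10 K11; ring.
case: dj => [|/forallP/(_ i)/implyP/(_ ni0)]; first by rewrite dN0 eqxx.
rewrite -detm det2E mi10 mulr0 subr0 mi11 mulrN oppr_eq0 -expr2 sqrf_eq0 => /eqP->.
by rewrite oppr0.
Qed.

End TwoByTwo.

(** * Isometric mixings with signs and phases, and the determinants they produce *)

Section Core.
Variable C : numClosedFieldType.
Local Notation sgn b := ((-1) ^+ nat_of_bool b).

(** Off the diagonal, flipping the sign at [i] alone is a bijection that negates the sum. *)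
Lemma signr_sum_orthogonal (I : finType) (i j : I) :
  \sum_(s : {ffun I -> bool}) (sgn (s i) * sgn (s j) : C)
    = (i == j)%:R * (2 ^ #|I|)%:R.
Proof.
have [->|nij] := eqVneq i j.
  rewrite (eq_bigr (fun=> 1)); last by move=> s _; rewrite -expr2 sqrr_sign.
  by rewrite sumr_const card_ffun card_bool mul1r.
rewrite mul0r; set S := \sum_s _.
pose flip (s : {ffun I -> bool}) := [ffun x => if x == i then ~~ s x else s x].
have flipK : involutive flip.
  by move=> s; apply/ffunP => x; rewrite !ffunE; case: eqP => // _; rewrite negbK.
have : S = - S.
  rewrite {1}/S (reindex_inj (inv_inj flipK)) /= -sumrN; apply: eq_bigr => s _.
  by rewrite !ffunE eqxx eq_sym (negPf nij) signrN mulNr.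
by move=> /eqP; rewrite -addr_eq0 -mulr2n mulrn_eq0 => /eqP.
Qed.

Lemma norm1_conjM (t : C) : `|t| = 1 -> t * t^* = 1.
Proof. by move=> t1; rewrite -normCK t1 expr1n. Qed.

Lemma unitary_col_orthogonal n (V : 'M[C]_n) i j : V \is unitarymx ->
  \sum_k V k i * (V k j)^* = (i == j)%:R.
Proof.
rewrite -trmx_unitary => /unitarymxP/matrixP/(_ i j); rewrite !mxE => <-.
by apply: eq_bigr => k _; rewrite !mxE.
Qed.

(* Averaging over all signs makes the cross terms of the determinant vanish
   while keeping the mixing isometric. *)
Definition sign_mix N (V : 'M[C]_N) (t : 'I_N -> C)
    (s : {ffun 'I_N -> bool}) (j : 'I_N) : C :=
  (sqrtC (2 ^ N)%:R)^-1 * \sum_i sgn (s i) * t i * V i j.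

Lemma sign_mix_isometry N (V : 'M[C]_N) t i j : V \is unitarymx ->
  (forall k, `|t k| = 1) ->
  \sum_s sign_mix V t s i * (sign_mix V t s j)^* = (i == j)%:R.
Proof.
move=> Vu t1; pose a : C := (sqrtC (2 ^ N)%:R)^-1.
have aE : a * a^* = (2 ^ N)%:R^-1.
  by rewrite geC0_conj ?invr_ge0 ?sqrtC_ge0 // -expr2 exprVn sqrtCK.
transitivity (\sum_(s : {ffun _ -> bool}) \sum_k \sum_l
   (2 ^ N)%:R^-1 * (t k * V k i * (t l * V l j)^*) * (sgn (s k) * sgn (s l))).
  apply: eq_bigr => s _; rewrite /sign_mix -/a rmorphM mulrACA aE rmorph_sum.
  rewrite mulr_suml mulr_sumr; apply: eq_bigr => k _.
  rewrite !mulr_sumr; apply: eq_bigr => l _.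
  by rewrite !rmorphM /= rmorph_sign; ring.
rewrite exchange_big -(unitary_col_orthogonal i j Vu); apply: eq_bigr => k _ /=.
rewrite exchange_big (bigD1 k) //= [X in _ + X]big1 ?addr0 => [|l lk].
  rewrite -mulr_sumr signr_sum_orthogonal eqxx mul1r card_ord rmorphM /=.
  rewrite mulrAC mulVf ?pnatr_eq0 ?expn_eq0 // mul1r mulrACA.
  by rewrite norm1_conjM // mul1r.
by rewrite -mulr_sumr signr_sum_orthogonal eq_sym (negPf lk) mul0r mulr0.
Qed.

(** In the determinant of an orthogonal combination only squared coefficients occur, so the signs
    drop out and the [2 ^ N] terms are equal. *)
Lemma sign_mix_det N (V : 'M[C]_N) t (M : 'I_N -> 'M[C]_2)
    (F := fun i => \sum_j V i j *: M j) :
  (forall i j, i != j -> polar (F i) (F j) = 0) ->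
  \sum_s 2 * `|\det (\sum_j sign_mix V t s j *: M j)|
    = 2 * `|\sum_i t i ^+ 2 * \det (F i)|.
Proof.
move=> orth; pose a : C := (sqrtC (2 ^ N)%:R)^-1.
have aE : a ^+ 2 = (2 ^ N)%:R^-1 by rewrite exprVn sqrtCK.
have detE s : \det (\sum_j sign_mix V t s j *: M j)
    = (2 ^ N)%:R^-1 * \sum_i t i ^+ 2 * \det (F i).
  have -> : \sum_j sign_mix V t s j *: M j
      = \sum_i (a * (sgn (s i) * t i)) *: F i.
    transitivity (\sum_j \sum_i (a * (sgn (s i) * t i) * V i j) *: M j).
      apply: eq_bigr => j _; rewrite /sign_mix -/a -scaler_suml; congr (_ *: _).
      by rewrite mulr_sumr; apply: eq_bigr => i _; rewrite mulrA.
    rewrite exchange_big; apply: eq_bigr => i _; rewrite scaler_sumr.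
    by apply: eq_bigr => j _; rewrite scalerA.
  rewrite det_orthogonal_sum // mulr_sumr; apply: eq_bigr => i _.
  by rewrite !exprMn aE sqrr_sign mul1r -mulrA.
under eq_bigr do rewrite detE normrM.
rewrite sumr_const card_ffun card_bool card_ord -mulr_natl.
rewrite ger0_norm ?invr_ge0 //.
by field; rewrite pnatr_eq0 expn_eq0.
Qed.

(** Takagi applied to the Gram matrix of [M] for [polar]: mixing the family by [V] acts on that
    matrix by congruence. *)
Lemma takagi_family N (M : 'I_N -> 'M[C]_2) :
  exists2 V : 'M[C]_N, V \is unitarymx &
    forall i j, i != j ->
      polar (\sum_k V i k *: M k) (\sum_k V j k *: M k) = 0.
Proof.
pose T := \matrix_(i, j) polar (M i) (M j).
have sT : T^T = T by apply/matrixP => i j; rewrite !mxE polarC.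
have [V Vu /is_diag_mxP Vd] := takagi sT; exists V => // i j ij.
rewrite -[RHS](Vd i j ij) polar_suml mxE.
under eq_bigr do rewrite polar_sumr mulr_sumr.
rewrite exchange_big; apply: eq_bigr => l _ /=.
rewrite !mxE mulr_suml; apply: eq_bigr => k _.
by rewrite !mxE; ring.
Qed.

End Core.

(** * The certifying observable and the monogamy inequality for one pure state *)

Section CoreInequality.
Variable C : numClosedFieldType.
Local Notation dag M := (map_mx (@Num.conj C) M^T).

Lemma dagM m n p (A : 'M[C]_(m, n)) (B : 'M[C]_(n, p)) :
  dag (A *m B) = dag B *m dag A.
Proof. by rewrite trmx_mul map_mxM. Qed.

Lemma dagE m n (A : 'M[C]_(m, n)) i j : dag A i j = (A j i)^*.
Proof. by rewrite !mxE. Qed.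

Lemma det_dag n (A : 'M[C]_n) : \det (dag A) = (\det A)^*.
Proof. by rewrite det_map_mx det_tr. Qed.

(** The phase rotates [g] onto the imaginary axis. It serves to make a conjugated antidiagonal
    observable traceless. *)
Lemma orthogonal_phase (g : C) : exists2 z, `|z| = 1 & g * z + (g * z)^* = 0.
Proof.
have [->|g0] := eqVneq g 0.
  by exists 1; rewrite ?normr1 // mul0r conjC0 addr0.
exists ('i * g^* / `|g|).
  by rewrite !normrM normCi mul1r norm_conjC normfV normr_id divff // normr_eq0.
have -> : g * ('i * g^* / `|g|) = 'i * `|g|.
  have -> : g * ('i * g^* / `|g|) = 'i * (g * g^*) / `|g| by ring.
  by rewrite -normCK expr2 mulrA mulfK // normr_eq0.
by rewrite rmorphM /= conjCi conj_normC mulNr subrr.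
Qed.

Lemma square_phase (x y : C) : `|x| = `|y| ->
  exists2 t, `|t| = 1 & t ^+ 2 * x = y.
Proof.
have [->|x0] := eqVneq x 0.
  rewrite normr0 => /esym/normr0_eq0->; exists 1; first exact: normr1.
  by rewrite mulr0.
move=> xy; exists (sqrtC (y / x)); last by rewrite sqrtCK divfK.
apply/eqP; rewrite -(@pexpr_eq1 _ _ 2) // -normrX sqrtCK normrM normfV -xy.
by rewrite divff // normr_eq0.
Qed.

Lemma hermitian2_traceless_det_le0 (X : 'M[C]_2) :
  dag X = X -> X 0 0 + X 1 1 = 0 -> \det X <= 0.
Proof.
move=> hX /eqP; rewrite addr_eq0 => /eqP X00; rewrite det2E.
have -> : X 1 0 = (X 0 1)^* by rewrite -{1}hX dagE.
rewrite -normCK {1}X00 mulNr.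
have -> : X 1 1 * X 1 1 = `|X 1 1| ^+ 2 by rewrite normCK -dagE hX.
by rewrite -opprD oppr_le0 addr_ge0 // exprn_ge0.
Qed.

Definition antidiag_herm (z : C) : 'M[C]_2 := mx2 0 z z^* 0.

(** The upper right entry of [m *m antidiag_herm z *m dag m]. *)
Definition antidiag_image (z : C) (m : 'M[C]_2) : C :=
  m 0 0 * z * (m 1 1)^* + m 0 1 * z^* * (m 1 0)^*.

Lemma conj_antidiag_herm (z : C) (m : 'M[C]_2) : diag_or_antidiag m ->
  m *m antidiag_herm z *m dag m = antidiag_herm (antidiag_image z m).
Proof.
rewrite /antidiag_image => -[[h1 h2]|[h1 h2]]; apply: matrix2P;
  rewrite !mulmx2E !dagE !mx2E ?h1 ?h2 ?rmorphD ?rmorphM /= ?conjCK ?conjC0;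
  by ring.
Qed.

(** This equality of moduli is what allows phases to align the determinants of the [m i] with their
    images. *)
Lemma norm_antidiag_image (z : C) (m : 'M[C]_2) : diag_or_antidiag m ->
  `|antidiag_image z m| = `|z| * `|\det m|.
Proof.
rewrite /antidiag_image det2E => -[[-> ->]|[-> ->]];
  rewrite ?mul0r ?mulr0 ?conjC0 ?mulr0 ?addr0 ?subr0 ?sub0r ?add0r ?normrN;
  by rewrite !normrM !norm_conjC; ring.
Qed.

Lemma sum_antidiag_herm (I : finType) (f : I -> C) :
  \sum_i antidiag_herm (f i) = antidiag_herm (\sum_i f i).
Proof.
apply: matrix2P; rewrite summxE mx2E; under eq_bigr do rewrite mx2E;
  rewrite ?sumr_const ?mul0rn //.
by rewrite rmorph_sum.
Qed.

(* [n] is the observable on the second factor that certifies the concurrence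
   [2 `|\sum_i t i ^+ 2 * \det (F i)|] of the mixture of the [F i]. *)
Lemma certifying_observable (I : finType) (F : I -> 'M[C]_2) :
    (forall i j, i != j -> polar (F i) (F j) = 0) ->
  exists (t : I -> C) (n : 'M[C]_2),
    [/\ forall i, `|t i| = 1, dag n = n, n 0 0 + n 1 1 = 0, \det n = -1 &
        `|\sum_i t i ^+ 2 * \det (F i)| ^+ 2
          <= - \det (\sum_i F i *m n *m dag (F i))].
Proof.
move=> orth.
have [/existsP[i0 d0]|] := boolP [exists i, \det (F i) != 0]; last first.
  rewrite negb_exists => /forallP d0.
  (* All determinants vanish, hence so does the left side, and it is enough that the image of the
     observable be traceless. For an antidiagonal observable this trace depends only on the
     off-diagonal entries of [G]. *)
  pose G : 'M[C]_2 := \sum_i dag (F i) *m F i.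
  have [z z1 zG] := orthogonal_phase (G 1 0).
  exists (fun=> 1), (antidiag_herm z); split.
  - by move=> _; rewrite normr1.
  - by apply: matrix2P; rewrite dagE !mx2E ?conjCK ?conjC0.
  - by rewrite !mx2E addr0.
  - by rewrite det2E !mx2E mul0r sub0r norm1_conjM.
  rewrite big1 => [|i _]; last by have := d0 i; rewrite negbK => /eqP->; rewrite mulr0.
  rewrite normr0 expr0n /= oppr_ge0; apply: hermitian2_traceless_det_le0.
    rewrite raddf_sum /= rmorph_sum /=; apply: eq_bigr => i _.
    rewrite !dagM trmxCK mulmxA; congr (_ *m _ *m _).
    by apply: matrix2P; rewrite dagE !mx2E ?conjCK ?conjC0.
  rewrite -zG !summxE -!big_split /= mulr_suml rmorph_sum -big_split /=.
  apply: eq_bigr => i _; rewrite !mulmx2E !dagE !mx2E !rmorphM !rmorphD /=.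
  by rewrite !rmorphM /= ?conjCK; ring.
have [A [L [m [Lu FE md]]]] := orthogonal_family_normal_form orth d0.
(* The observable is [P *m antidiag_herm z *m dag P], so that conjugation by [L] makes it
   antidiagonal. The modulus of [z] normalises its determinant to -1 and the phase of [z] cancels
   its trace, read off [G]. *)
pose P := invmx L; pose G := dag P *m P.
have dL0 : `|\det L| != 0 by rewrite normr_eq0 -unitfE -unitmxE.
have [z0 z01 z0G] := orthogonal_phase (G 1 0).
have [z zn zE] : exists2 z, `|z| = `|\det L| & z = `|\det L| * z0.
  by exists (`|\det L| * z0); rewrite // normrM normr_id z01 mulr1.
pose e i := antidiag_image z (m i).
(* With these phases both sides of the final bound equal the squared modulus of
   [\det A * \sum_i e i]. *)
have tP i : exists t, `|t| = 1 /\ t ^+ 2 * (`|z| * \det (m i)) = e i.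
  have [|t t1 tE] := @square_phase (`|z| * \det (m i)) (e i).
    by rewrite normrM normr_id norm_antidiag_image.
  by exists t.
have [t tE] := fin_all_exists tP.
exists t, (P *m antidiag_herm z *m dag P).
have hz : dag (antidiag_herm z) = antidiag_herm z.
  by apply: matrix2P; rewrite dagE !mx2E ?conjCK ?conjC0.
have dz : \det (antidiag_herm z) = - `|z| ^+ 2.
  by rewrite det2E !mx2E mul0r sub0r normCK.
split.
- by move=> i; case: (tE i).
- by rewrite !dagM trmxCK hz mulmxA.
- transitivity (`|\det L| * (G 1 0 * z0 + (G 1 0 * z0)^*)); last by rewrite z0G mulr0.
  rewrite /G !mulmx2E !dagE !mx2E !rmorphM !rmorphD /= !rmorphM /= ?conjCK.
  by rewrite zE rmorphM /= conj_normC; ring.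
- rewrite !det_mulmx det_dag dz mulrAC -normCK det_inv normfV zn.
  by rewrite mulrN -exprMn mulVf // expr1n.
have -> : \sum_i F i *m (P *m antidiag_herm z *m dag P) *m dag (F i)
    = A *m antidiag_herm (\sum_i e i) *m dag A.
  rewrite -sum_antidiag_herm mulmx_sumr mulmx_suml; apply: eq_bigr => i _.
  rewrite -conj_antidiag_herm // FE !dagM !mulmxA mulmxK //.
  congr (_ *m _); congr (_ *m _); rewrite -mulmxA -dagM mulmxV //.
  by rewrite trmx1 map_mx1 mulmx1.
have -> : \sum_i t i ^+ 2 * \det (F i) = \det A * \det L / `|z| * \sum_i e i.
  rewrite mulr_sumr; apply: eq_bigr => i _; case: (tE i) => _ <-.
  by rewrite FE !det_mulmx; field; rewrite zn.
rewrite !det_mulmx det_dag [\det (antidiag_herm _)]det2E !mx2E mul0r sub0r.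
rewrite !normrM normfV normr_id zn mulfK // !mulrN mulNr opprK -!normCK.
by rewrite mulrAC -normCK -exprMn.
Qed.

(** The Gram determinant of two vectors. When they hold the amplitudes of a pure state for the two
    values of a qubit, it is the determinant of the reduced matrix of that qubit. *)
Definition gram2 (I : finType) (p q : I -> C) : C :=
  (\sum_i `|p i| ^+ 2) * (\sum_i `|q i| ^+ 2) - `|\sum_i p i * (q i)^*| ^+ 2.

(** Lagrange's identity writes twice the Gram determinant as a sum of squared moduli of 2x2
    minors. *)
Lemma gram2_ge0 (I : finType) (p q : I -> C) : 0 <= gram2 p q.
Proof.
rewrite -(@pmulr_rge0 _ 2) ?ltr0n //.
have -> : 2 * gram2 p q = \sum_i \sum_j `|p i * q j - p j * q i| ^+ 2.
  pose f i j := `|p i| ^+ 2 * `|q j| ^+ 2 - p i * (q i)^* * (p j * (q j)^*)^*.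
  have fE : gram2 p q = \sum_i \sum_j f i j.
    rewrite /gram2 normCK rmorph_sum !mulr_suml -sumrB; apply: eq_bigr => i _.
    by rewrite !mulr_sumr -sumrB.
  rewrite mulr_natl mulr2n {2}fE exchange_big fE -big_split /=.
  apply: eq_bigr => i _; rewrite -big_split /=; apply: eq_bigr => j _.
  by rewrite /f !normCK rmorphB !rmorphM /= !conjCK; ring.
by apply: sumr_ge0 => i _; apply: sumr_ge0 => j _; rewrite exprn_ge0.
Qed.

Lemma det_sum_conj2 (I : finType) (B : I -> 'M[C]_2) k :
  \det (\sum_i B i *m delta_mx k k *m dag (B i))
    = gram2 (fun i => B i 0 k) (fun i => B i 1 k).
Proof.
have BE i a b : (B i *m delta_mx k k *m dag (B i)) a b = B i a k * (B i b k)^*.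
  rewrite mxE (bigD1 k) //= dagE big1 ?addr0 => [|l lk].
    rewrite mxE (bigD1 k) //= mxE !eqxx mulr1 big1 ?addr0 // => l lk.
    by rewrite mxE (negPf lk) mulr0.
  by rewrite mxE big1 ?mul0r // => l' _; rewrite mxE (negPf lk) andbF mulr0.
have HE a b : (\sum_i B i *m delta_mx k k *m dag (B i)) a b
    = \sum_i B i a k * (B i b k)^*.
  by rewrite summxE; apply: eq_bigr => i _; rewrite BE.
rewrite det2E !HE /gram2 normCK rmorph_sum.
congr (_ * _ - _ * _); apply: eq_bigr => i _; rewrite ?normCK //.
by rewrite rmorphM /= conjCK mulrC.
Qed.

(** The eigenvalues are opposite with product -1; the diagonalisation does not prescribe their
    order, hence the sign [s]. *)
Lemma traceless_involution_spectral (n : 'M[C]_2) :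
    dag n = n -> n 0 0 + n 1 1 = 0 -> \det n = -1 ->
  exists2 Q : 'M[C]_2, Q \is unitarymx & exists2 s : C, s ^+ 2 = 1 &
    n = Q *m (s *: (delta_mx 0 0 - delta_mx 1 1)) *m dag Q.
Proof.
move=> hn trn detn.
have /orthomx_spectralP nE : n \is normalmx by apply/normalmxP; rewrite hn.
have Pu := spectral_unitarymx n.
set P := spectralmx n in nE Pu; set sp := spectral_diag n in nE.
have iP := invmx_unitary Pu.
exists (dag P); first by rewrite trmxC_unitary.
have sp01 : sp 0 1 = - sp 0 0.
  have : \tr n = 0.
    rewrite -trn /mxtrace !big_ord_recl big_ord0 addr0.
    by congr (_ + n _ _); apply/val_inj.
  rewrite nE mxtrace_mulC mulmxA mulmxV ?unitarymx_unit // mul1mx.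
  rewrite mxtrace_diag !big_ord_recl big_ord0 addr0 addrC => /eqP.
  by rewrite addr_eq0 => /eqP <-; congr (sp _ _); apply/val_inj.
exists (sp 0 0).
  have : \det n = \det (diag_mx sp).
    rewrite nE !det_mulmx det_inv mulrAC mulVf ?mul1r //.
    by rewrite -unitfE -unitmxE unitarymx_unit.
  rewrite detn det2E !mxE /= !mulr0n !mulr1n mul0r subr0 sp01 mulrN -expr2.
  by move=> /oppr_inj.
rewrite trmxCK -iP {1}nE; congr (_ *m _ *m _).
by apply: matrix2P; rewrite !mxE /= ?mulr1n ?mulr0n ?sp01;
  rewrite ?subr0 ?sub0r ?mulr1 ?mulrN1 ?mulr0 // oppr0 mulr0.
Qed.

Lemma concurrence_core N (M : 'I_N -> 'M[C]_2) :
  exists (W : {ffun 'I_N -> bool} -> 'I_N -> C) (Q : 'M[C]_2),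
    [/\ forall i j, \sum_s W s i * (W s j)^* = (i == j)%:R,
        Q \is unitarymx &
        (\sum_s 2 * `|\det (\sum_j W s j *: M j)|) ^+ 2
        + (\sum_k 2 * sqrtC (gram2 (fun i => (M i *m Q) 0 k)
                                   (fun i => (M i *m Q) 1 k))) ^+ 2
        <= 4 * \det (\sum_i M i *m dag (M i))].
Proof.
have [V Vu orth] := takagi_family M.
pose F i := \sum_j V i j *: M j.
have [t [n [t1 hn trn detn ineq]]] := certifying_observable orth.
have [Q Qu [s s2 nE]] := traceless_involution_spectral hn trn detn.
exists (sign_mix V t), Q; split=> //; first by move=> i j; apply: sign_mix_isometry.
(* [H k] is the unnormalised state of the first factor after outcome [k], when the second factor is
   measured along the columns of [Q]. Unitary mixing of the family does not affect such sums
   ([EF]). *)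
pose H k := \sum_i (M i *m Q) *m delta_mx k k *m dag (M i *m Q).
have EF X : \sum_i F i *m X *m dag (F i) = \sum_i M i *m X *m dag (M i).
  transitivity (\sum_i \sum_j \sum_k (V i j * (V i k)^*) *: (M j *m X *m dag (M k))).
    apply: eq_bigr => i _; rewrite !mulmx_suml; apply: eq_bigr => j _.
    rewrite raddf_sum /= rmorph_sum /= mulmx_sumr; apply: eq_bigr => k _.
    by rewrite linearZ /= map_mxZ /= -!scalemxAl -scalemxAr scalerA.
  rewrite exchange_big; apply: eq_bigr => j _ /=; rewrite exchange_big /=.
  rewrite (bigD1 j) //= [X in _ + X]big1 ?addr0 => [|k kj];
    rewrite -scaler_suml unitary_col_orthogonal //.
    by rewrite eqxx scale1r.
  by rewrite eq_sym (negPf kj) scale0r.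
have En : \sum_i F i *m n *m dag (F i) = s *: (H 0 - H 1).
  rewrite EF /H -sumrB scaler_sumr; apply: eq_bigr => i _.
  by rewrite nE !dagM !mulmxA -scalemxAr -!scalemxAl -!mulmxBl -mulmxBr.
have E1 : \sum_i M i *m dag (M i) = H 0 + H 1.
  rewrite /H -big_split; apply: eq_bigr => i _ /=.
  rewrite -mulmxDl -mulmxDr (_ : delta_mx 0 0 + delta_mx 1 1 = 1%:M).
    rewrite mulmx1 dagM mulmxA -(mulmxA (M i)) (unitarymxP Qu) mulmx1 //.
  by apply: matrix2P; rewrite !mxE /= ?addr0 ?add0r.
rewrite E1 sign_mix_det // exprMn.
have -> : (2 : C) ^+ 2 = 4 by ring.
apply: (@le_trans _ _ (4 * - \det (H 0 - H 1)
    + (\sum_k 2 * sqrtC (\det (H k))) ^+ 2)).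
  rewrite lerD //; last first.
    by under [X in _ <= X ^+ 2]eq_bigr do rewrite det_sum_conj2.
  rewrite ler_pM2l ?ltr0n //.
  have -> : \det (H 0 - H 1) = \det (s *: (H 0 - H 1)) by rewrite detZ s2 mul1r.
  by rewrite -En.
have dH k : 0 <= \det (H k) by rewrite det_sum_conj2 gram2_ge0.
rewrite !big_ord_recl big_ord0 addr0.
have -> : lift ord0 ord0 = 1 :> 'I_2 by apply/val_inj.
set a := sqrtC _; set b := sqrtC _.
have aR : a \is Num.real by rewrite ger0_real // sqrtC_ge0.
have bR : b \is Num.real by rewrite ger0_real // sqrtC_ge0.
(* The parallelogram law for the quadratic form [\det]; the slack left in the inequality is then a
   multiple of a square. *)
have dD : \det (H 0 + H 1) = 2 * (a ^+ 2 + b ^+ 2) - \det (H 0 - H 1).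
  by rewrite !sqrtCK !det2E !mxE; ring.
rewrite dD -subr_ge0.
have -> : 4 * (2 * (a ^+ 2 + b ^+ 2) - \det (H 0 - H 1))
  - (4 * - \det (H 0 - H 1) + (2 * a + 2 * b) ^+ 2) = 4 * (a - b) ^+ 2 by ring.
by rewrite mulr_ge0 // real_exprn_even_ge0 // rpredB.
Qed.

End CoreInequality.

(** * Configurations of subsets of qubits, and sums over them *)

Section Configurations.
Variable I : finType.
Implicit Types (P : pred I) (f g h : cfg I).

(* A configuration of the qubits in [P] is represented by the configuration of
   [I] which vanishes outside [P]. *)
Definition supp P h : bool := [forall x, h x ==> P x].

(** For disjoint supports this is concatenation, so joint configurations of several subsystems stay
    inside the single type [cfg I]. *)
Definition cor f g : cfg I := [ffun x => f x || g x].

Definition pt (x : I) (b : bool) : cfg I := [ffun y => (y == x) && b].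

Definition restr P h : cfg {x | P x} := [ffun s => h (val s)].

Definition extend P (a : cfg {x | P x}) : cfg I :=
  [ffun x => if insub x is Some s then a s else false].

Definition cut P h : cfg I := [ffun x => h x && P x].

Lemma suppP P h : reflect (forall x, ~~ P x -> h x = false) (supp P h).
Proof.
apply: (iffP forallP) => H x; last by apply/implyP; apply: contraTT => /H ->.
by move=> nPx; have := H x; rewrite (negPf nPx) implybF => /negbTE.
Qed.

Lemma supp_cut P h : supp P (cut P h).
Proof. by apply/suppP => x /negPf nPx; rewrite ffunE nPx andbF. Qed.

Lemma supp_sub P P' h : subpred P P' -> supp P h -> supp P' h.
Proof. by move=> sP /suppP H; apply/suppP => x /(contra (sP x)); apply: H. Qed.

Lemma supp_cor P f g : supp P f -> supp P g -> supp P (cor f g).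
Proof.
by move=> /suppP F /suppP G; apply/suppP => x Px; rewrite ffunE F ?G.
Qed.

Lemma supp_pt P x b : P x -> supp P (pt x b).
Proof.
by move=> Px; apply/suppP => y; rewrite ffunE; case: eqP => // ->; rewrite Px.
Qed.

Lemma supp_extend P (a : cfg {x | P x}) : supp P (extend a).
Proof. by apply/suppP => x nPx; rewrite ffunE insubN. Qed.

Lemma extendK P (a : cfg {x | P x}) : restr P (extend a) = a.
Proof. by apply/ffunP => s; rewrite !ffunE valK. Qed.

Lemma restrK P h : supp P h -> extend (restr P h) = h.
Proof.
move=> /suppP H; apply/ffunP => x; rewrite ffunE.
by case: insubP => [s _ <-|nPx]; [rewrite ffunE | rewrite H].
Qed.

Section Sums.
Variable V : nmodType.

Lemma sum_restr P (F : cfg {x | P x} -> V) :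
  \sum_a F a = \sum_(h | supp P h) F (restr P h).
Proof.
rewrite (reindex_onto (restr P) (@extend P)) => [|a _]; last exact: extendK.
apply: eq_bigl => h; apply/eqP/idP => [<-|/restrK //]; exact: supp_extend.
Qed.

Lemma sum_supp_split P Q R (F : cfg I -> V) :
    (forall x, R x = P x || Q x) -> (forall x, P x -> ~~ Q x) ->
  \sum_(h | supp R h) F h = \sum_(f | supp P f) \sum_(g | supp Q g) F (cor f g).
Proof.
move=> RE PQ; rewrite pair_big /=.
rewrite (reindex_onto (fun fg : cfg I * cfg I => cor fg.1 fg.2)
   (fun h => (cut P h, cut Q h))) => [|h /suppP Rh] /=.
  apply: eq_bigl => -[f g] /=; apply/andP/andP => [[_ /eqP[<- <-]]|[Pf Qg]].
    by rewrite !supp_cut.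
  split.
    by apply: supp_cor; [apply: supp_sub Pf|apply: supp_sub Qg] => x;
      rewrite RE => ->; rewrite ?orbT.
  have /suppP Pf' := Pf; have /suppP Qg' := Qg.
  apply/eqP; congr (_, _); apply/ffunP => x; rewrite !ffunE.
    case Px: (P x); last by rewrite andbF Pf' ?Px.
    by rewrite (Qg' x) ?PQ // orbF andbT.
  case Qx: (Q x); last by rewrite andbF Qg' ?Qx.
  by rewrite (Pf' x) ?andbT //; apply: contraL Qx; apply: PQ.
apply/ffunP => x; rewrite !ffunE -andb_orr -RE.
by case Rx: (R x); rewrite ?andbT // andbF Rh ?Rx.
Qed.

Lemma sum_supp1 P x (F : cfg I -> V) : P =1 pred1 x ->
  \sum_(h | supp P h) F h = F (pt x false) + F (pt x true).
Proof.
move=> PE; have ptI : pt x true != pt x false.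
  by apply/eqP => /ffunP/(_ x); rewrite !ffunE eqxx.
rewrite (bigD1 (pt x false)) /=; last by rewrite supp_pt // PE /= eqxx.
rewrite (bigD1 (pt x true)) /=; last by rewrite ptI supp_pt // PE /= eqxx.
rewrite big1 ?addr0 // => h /andP[/andP[/suppP Ph h0] h1].
suff hE : h = pt x (h x) by case: (h x) hE h0 h1 => ->; rewrite eqxx.
apply/ffunP => y; rewrite ffunE; case: eqP => [->//|/eqP ny] /=.
by rewrite Ph // PE.
Qed.

Lemma supp_eq P Q h : P =1 Q -> supp P h = supp Q h.
Proof. by move=> PQ; apply: eq_forallb => x; rewrite PQ. Qed.

End Sums.
End Configurations.

(** * Partial traces in terms of supports *)

Section PartialTrace.
Variables (R : realType) (I : finType).
Local Notation C := R[i].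
Implicit Types (P : pred I) (rho : op R (cfg I)).

Lemma cjoin_restr P (f c : cfg I) : supp P f -> supp (predC P) c ->
  cjoin (restr P f) (restr (fun x => ~~ P x) c) = cor f c.
Proof.
move=> /suppP Pf /suppP Pc; apply/ffunP => x; rewrite !ffunE.
case: insubP => [s Ps <-|nPx]; first by rewrite ffunE (Pc (val s)) ?orbF //= negbK (valP s).
rewrite (Pf x nPx); case: insubP => [t _ <-|]; first by rewrite ffunE.
by rewrite nPx.
Qed.

Lemma ptrace_restr P rho (f g : cfg I) : supp P f -> supp P g ->
  @ptrace R I P rho (restr P f) (restr P g)
    = \sum_(c | supp (predC P) c) rho (cor f c) (cor g c).
Proof.
move=> Pf Pg; rewrite /ptrace sum_restr; apply: eq_bigr => c Pc.
by rewrite !cjoin_restr.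
Qed.

Lemma corA (f g h : cfg I) : cor f (cor g h) = cor (cor f g) h.
Proof. by apply/ffunP => x; rewrite !ffunE orbA. Qed.

Lemma corC (f g : cfg I) : cor f g = cor g f.
Proof. by apply/ffunP => x; rewrite !ffunE orbC. Qed.

(** Tracing in two stages: the complement of [P1] is the disjoint union of [P2] and the complement
    of [P]. *)
Lemma ptrace_tower P P1 P2 rho (f g : cfg I) :
    (forall x, P x = P1 x || P2 x) -> (forall x, P1 x -> ~~ P2 x) ->
    supp P1 f -> supp P1 g ->
  @ptrace R I P1 rho (restr P1 f) (restr P1 g) = \sum_(h | supp P2 h)
    @ptrace R I P rho (restr P (cor f h)) (restr P (cor g h)).
Proof.
move=> PE P12 f1 g1; rewrite ptrace_restr //.
rewrite (@sum_supp_split _ _ P2 (predC P)); last 2 first.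
- by move=> x /=; rewrite PE; have := P12 x; case: (P1 x); case: (P2 x) => // /(_ isT).
- by move=> x /= P2x; rewrite PE P2x orbT.
have s1 : subpred P1 P by move=> x; rewrite PE => ->.
have s2 : subpred P2 P by move=> x; rewrite PE orbC => ->.
apply: eq_bigr => h h2.
rewrite ptrace_restr; try by apply: supp_cor; [apply: supp_sub s1 _ | apply: supp_sub s2 _].
by apply: eq_bigr => c _; rewrite !corA.
Qed.

Lemma trace_ptrace P rho : trace (@ptrace R I P rho) = trace rho.
Proof.
rewrite /trace sum_restr.
have -> : \sum_a rho a a = \sum_(h | supp predT h) rho h h.
  by apply: eq_bigl => h; apply/esym/suppP.
rewrite (@sum_supp_split _ _ P (predC P) predT) => [|x|x] /=; last 2 first.
- by case: (P x).
- by rewrite negbK.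
by apply: eq_bigr => f Pf; rewrite ptrace_restr.
Qed.

End PartialTrace.

(** * Concurrence of unnormalised vectors, and the convex roof over their decompositions *)

Section UnnormalizedConcurrence.
Variables (R : realType) (I : finType) (x0 : I).
Local Notation C := R[i].
Local Notation toC := (real_complex R).
Implicit Types (P : pred I) (chi : cfg I -> C).

Definition without P : pred I := [pred x | (x != x0) && P x].

Lemma withoutE P x : without P x = (x != x0) && P x.
Proof. by []. Qed.

(** The part of [chi] where the qubit [x0] has value [b], padded by zeros so that [gram2] may sum
    over all configurations. *)
Definition slice P (b : bool) chi : cfg I -> C :=
  fun c => if supp (without P) c then chi (cor (pt x0 b) c) else 0.

(* Twice the root of the determinant of the unnormalised reduced state of the
   qubit [x0]; it extends [pure_conc] to arbitrary vectors, homogeneously of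
   degree two. *)
Definition uconc P chi : R :=
  2 * Num.sqrt (complex.Re (gram2 (slice P false chi) (slice P true chi))).

Lemma Re_ge0K (z : C) : 0 <= z -> toC (complex.Re z) = z.
Proof. by move=> z0; rewrite RRe_real // ger0_real. Qed.

Lemma Re_ge0 (z : C) : 0 <= z -> 0 <= complex.Re z.
Proof. by move=> z0; rewrite -ler0c Re_ge0K. Qed.

Lemma uconc_ge0 P chi : 0 <= uconc P chi.
Proof. by rewrite mulr_ge0 // sqrtr_ge0. Qed.

Lemma sqrtC_real (z : C) : 0 <= z ->
  sqrtC z = toC (Num.sqrt (complex.Re z)).
Proof.
move=> z0; apply/eqP; rewrite -(@eqrXn2 _ 2) ?sqrtC_ge0 ?ler0c ?sqrtr_ge0 //.
by rewrite sqrtCK -rmorphXn /= sqr_sqrtr ?Re_ge0K // Re_ge0.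
Qed.

Lemma uconcE P chi :
  toC (uconc P chi) = 2 * sqrtC (gram2 (slice P false chi) (slice P true chi)).
Proof. by rewrite rmorphM /= rmorph_nat sqrtC_real // gram2_ge0. Qed.

Lemma eq_gram2 (T : finType) (p p' q q' : T -> C) :
  p =1 p' -> q =1 q' -> gram2 p q = gram2 p' q'.
Proof.
move=> pp qq; rewrite /gram2.
have -> : \sum_i p i * Num.conj (q i) = \sum_i p' i * Num.conj (q' i).
  by apply: eq_bigr => i _; rewrite pp qq.
by congr (_ * _ - _); apply: eq_bigr => i _; rewrite ?pp ?qq.
Qed.

Lemma gram2Z (T : finType) (c : C) (p q : T -> C) :
  gram2 (fun i => c * p i) (fun i => c * q i) = (`|c| ^+ 2) ^+ 2 * gram2 p q.
Proof.
rewrite /gram2.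
have E (f : T -> C) : \sum_i `|c * f i| ^+ 2 = `|c| ^+ 2 * \sum_i `|f i| ^+ 2.
  by rewrite mulr_sumr; apply: eq_bigr => i _; rewrite normrM exprMn.
have -> : \sum_i c * p i * Num.conj (c * q i)
    = `|c| ^+ 2 * \sum_i p i * Num.conj (q i).
  by rewrite mulr_sumr; apply: eq_bigr => i _; rewrite normCK rmorphM mulrACA.
rewrite !E normrM exprMn ger0_norm ?exprn_ge0 //; ring.
Qed.

Lemma uconcZ P (c : R) chi :
  uconc P (fun h => toC c * chi h) = c ^+ 2 * uconc P chi.
Proof.
rewrite /uconc; have -> : gram2 (slice P false (fun h => toC c * chi h))
    (slice P true (fun h => toC c * chi h))
    = toC ((c ^+ 2) ^+ 2) * gram2 (slice P false chi) (slice P true chi).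
  rewrite (@eq_gram2 _ _ (fun h => toC c * slice P false chi h)
    _ (fun h => toC c * slice P true chi h)) => [|h|h]; last 2 first.
  - by rewrite /slice; case: ifP; rewrite ?mulr0.
  - by rewrite /slice; case: ifP; rewrite ?mulr0.
  rewrite gram2Z normCK conj_Creal; last by rewrite complex_real.
  by rewrite -expr2 -!rmorphXn.
set g := gram2 _ _; have g0 : 0 <= g by apply: gram2_ge0.
rewrite -(Re_ge0K g0) -rmorphM /= sqrtrM ?exprn_even_ge0 //.
by rewrite sqrtr_sqr ger0_norm ?sqr_ge0 //; ring.
Qed.

Lemma supp_without P h : supp (without P) h -> supp P h.
Proof. by apply: supp_sub => x /andP[]. Qed.

Lemma sum_supp_without (V : nmodType) P (F : cfg I -> V) : P x0 ->
  \sum_(h | supp P h) F h = \sum_(c | supp (without P) c) F (cor (pt x0 false) c)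
                          + \sum_(c | supp (without P) c) F (cor (pt x0 true) c).
Proof.
move=> P0; rewrite (@sum_supp_split _ _ (pred1 x0) (without P) P) => [|x|x].
- by rewrite (@sum_supp1 _ _ (pred1 x0) x0).
- by rewrite withoutE /=; case: eqP => [->|_]; rewrite ?P0.
by move=> /eqP->; rewrite withoutE eqxx.
Qed.

Lemma eq_uconc P chi chi' : P x0 ->
  (forall h, supp P h -> chi h = chi' h) -> uconc P chi = uconc P chi'.
Proof.
move=> P0 E; have sE b : slice P b chi =1 slice P b chi'.
  move=> h; rewrite /slice; case: ifP => // hP; apply: E.
  by apply: supp_cor; [apply: supp_pt | apply: supp_without].
by rewrite /uconc (eq_gram2 (sE false) (sE true)).
Qed.

Lemma sum_slice P b b' chi :
  \sum_c slice P b chi c * Num.conj (slice P b' chi c)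
  = \sum_(c | supp (without P) c)
      chi (cor (pt x0 b) c) * Num.conj (chi (cor (pt x0 b') c)).
Proof.
rewrite [RHS]big_mkcond; apply: eq_bigr => c _; rewrite /slice.
by case: ifP; rewrite ?mul0r.
Qed.

Lemma sum_sig_cond (V : nmodType) P (K : pred (cfg {x | P x}))
    (F : cfg {x | P x} -> V) :
  \sum_(a | K a) F a = \sum_(h | supp P h && K (restr P h)) F (restr P h).
Proof. by rewrite big_mkcond sum_restr big_mkcondr. Qed.

(** A 2x2 matrix of trace one satisfies 1 - tr(rho^2) = 2 det(rho), as seen by replacing 1 by the
    squared trace; the determinant is the Gram determinant of the two slices. *)
Lemma pure_concE P (Q : pred {x | P x}) (phi : cfg {x | P x} -> C) :
    P x0 -> (forall y, Q y = (val y == x0)) -> normalized phi ->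
  pure_conc Q phi = uconc P (fun h => phi (restr P h)).
Proof.
move=> P0 QE nphi; pose y0 : {x | P x} := Sub x0 P0.
have Q1 : Q =1 pred1 y0 by move=> y; rewrite QE /= -val_eqE.
set chi := fun h => phi (restr P h).
pose G b b' := \sum_c slice P b chi c * Num.conj (slice P b' chi c).
have rQE b b' : @ptrace R _ Q (proj phi) (restr Q (pt y0 b)) (restr Q (pt y0 b'))
    = G b b'.
  rewrite ptrace_restr ?supp_pt ?Q1 /= ?eqxx // sum_sig_cond /G sum_slice.
  apply: eq_big => [h|h /andP[hP hQ]].
    apply/andP/idP => [[/suppP hP /suppP hQ]|hP].
      apply/suppP => x; rewrite withoutE negb_and negbK => /orP[/eqP->|]; last exact: hP.
      by have := hQ y0; rewrite /= Q1 /= eqxx ffunE => ->.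
    split; first exact: supp_without hP.
    apply/suppP => y /=; rewrite negbK Q1 /= => /eqP->; rewrite ffunE /=.
    by move/suppP: hP => -> //; rewrite withoutE /= eqxx.
  rewrite /proj /chi; congr (phi _ * Num.conj (phi _)); apply/ffunP => y;
    by rewrite !ffunE -val_eqE.
have trE : trace (opmul (@ptrace R _ Q (proj phi)) (@ptrace R _ Q (proj phi)))
   = G false false * G false false + G false true * G true false
   + (G true false * G false true + G true true * G true true).
  rewrite /trace sum_restr (@sum_supp1 _ _ _ y0) // /opmul.
  by rewrite !sum_restr !(@sum_supp1 _ _ _ y0) // !rQE.
have nG : G false false + G true true = 1.
  rewrite -nphi /normalized sum_restr sum_supp_without // /G !sum_slice.
  by congr (_ + _); apply: eq_bigr => c _; rewrite normCK.
have gE : gram2 (slice P false chi) (slice P true chi)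
    = G false false * G true true - G false true * G true false.
  rewrite /gram2; congr (_ * _ - _).
  - by apply: eq_bigr => c _; rewrite normCK.
  - by apply: eq_bigr => c _; rewrite normCK.
  rewrite normCK rmorph_sum; congr (_ * _); apply: eq_bigr => c _.
  by rewrite rmorphM /= conjCK mulrC.
have tr1 : trace (opmul (@ptrace R _ Q (proj phi)) (@ptrace R _ Q (proj phi)))
   = 1 - toC 2 * gram2 (slice P false chi) (slice P true chi).
  rewrite trE gE -[1 in RHS](expr1n _ 2) -{1}nG rmorph_nat.
  by ring.
rewrite /pure_conc tr1 /uconc; set g := gram2 _ _.
have g0 : 0 <= g by apply: gram2_ge0.
have -> : complex.Re (1 - toC 2 * g) = 1 - 2 * complex.Re g.
  by rewrite -(Re_ge0K g0) -rmorphM -(rmorph1 toC) -rmorphB.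
have -> : 2 * (1 - (1 - 2 * complex.Re g)) = 2 ^+ 2 * complex.Re g by ring.
by rewrite sqrtrM ?sqr_ge0 // sqrtr_sqr ger0_norm.
Qed.

(** An ensemble whose probabilities are absorbed into the vectors: any finite index type is allowed
    and no normalisation has to be maintained. *)
Definition decomposes P (sigma : op R (cfg {x | P x})) (S : finType)
    (chi : S -> cfg I -> C) : Prop :=
  forall f g, supp P f -> supp P g ->
    sigma (restr P f) (restr P g) = \sum_s chi s f * Num.conj (chi s g).

Lemma ensemble_of_decomposition P (Q : pred {x | P x})
    (sigma : op R (cfg {x | P x})) (S : finType) (chi : S -> cfg I -> C) :
    P x0 -> (forall y, Q y = (val y == x0)) -> trace sigma = 1 ->
    decomposes sigma chi ->
  exists m (pr : 'I_m -> R) (phi : 'I_m -> cfg {x | P x} -> C),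
    ensemble_of sigma pr phi /\
    \sum_(i < m) pr i * pure_conc Q (phi i) <= \sum_s uconc P (chi s).
Proof.
move=> P0 QE tr1 dec.
pose w s : R := complex.Re (\sum_(h | supp P h) `|chi s h| ^+ 2).
have wC s : toC (w s) = \sum_(h | supp P h) `|chi s h| ^+ 2.
  by rewrite Re_ge0K // sumr_ge0 // => h _; rewrite exprn_ge0.
have w0 s : 0 <= w s by rewrite -ler0c wC sumr_ge0 // => h _; rewrite exprn_ge0.
(* A null vector receives probability zero and a basis vector as placeholder, since members of an
   ensemble are normalised. *)
pose phi s (a : cfg {x | P x}) : C := if w s == 0 then (a == restr P (pt x0 false))%:R
  else toC (Num.sqrt (w s))^-1 * chi s (extend a).
have nphi s : normalized (phi s).
  rewrite /normalized /phi; case: eqP => [_|/eqP ws].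
    rewrite (bigD1 (restr P (pt x0 false))) //= eqxx normr1 expr1n big1 ?addr0 //.
    by move=> a /negPf->; rewrite normr0 expr0n.
  rewrite sum_restr.
  transitivity (toC (w s)^-1 * \sum_(h | supp P h) `|chi s h| ^+ 2).
    rewrite mulr_sumr; apply: eq_bigr => h hP; rewrite restrK // normrM exprMn.
    congr (_ * _); rewrite ger0_norm ?ler0c ?invr_ge0 ?sqrtr_ge0 //.
    by rewrite -rmorphXn /= exprVn sqr_sqrtr.
  by rewrite -wC -rmorphM /= mulVf // rmorph1.
have reE (F : S -> R) : \sum_(i < #|S|) F (enum_val i) = \sum_s F s.
  by rewrite (reindex (@enum_val _ S)) //; apply/onW_bij/enum_val_bij.
have reC (F : S -> C) : \sum_(i < #|S|) F (enum_val i) = \sum_s F s.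
  by rewrite (reindex (@enum_val _ S)) //; apply/onW_bij/enum_val_bij.
exists #|S|, (fun i => w (enum_val i)), (fun i => phi (enum_val i)); split.
  split=> [i||i|a b]; [exact: w0| |exact: nphi|].
    rewrite (reE w); apply: (@complexI R); rewrite rmorph1 -tr1 rmorph_sum /trace.
    rewrite sum_restr /= (eq_bigr _ (fun s _ => wC s)).
    rewrite exchange_big; apply: eq_bigr => h hP; rewrite dec //.
    by apply: eq_bigr => s _; rewrite normCK.
  rewrite (reC (fun s => toC (w s) * proj (phi s) a b)).
  rewrite -{1}(extendK a) -{1}(extendK b) dec ?supp_extend //.
  apply: eq_bigr => s _; rewrite /proj /phi; case: eqP => [ws|/eqP ws].
    rewrite ws mul0r; have : \sum_(h | supp P h) `|chi s h| ^+ 2 = 0.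
      by rewrite -wC ws.
    move=> /psumr_eq0P E.
    suff -> : chi s (extend a) = 0 by rewrite mul0r.
    apply/eqP; rewrite -normr_eq0 -sqrf_eq0 E ?supp_extend //.
    by move=> h _; rewrite exprn_ge0.
  set c := (Num.sqrt (w s))^-1; rewrite rmorphM /= [Num.conj (toC c)]conj_Creal; last first.
    by rewrite complex_real.
  have -> : toC (w s) * (toC c * chi s (extend a) * (toC c * Num.conj (chi s (extend b))))
    = toC (w s * c ^+ 2) * (chi s (extend a) * Num.conj (chi s (extend b))).
    by rewrite rmorphM rmorphXn /=; ring.
  by rewrite exprVn sqr_sqrtr // mulfV // rmorph1 mul1r.
rewrite (reE (fun s => w s * pure_conc Q (phi s))); apply: ler_sum => s _.
rewrite pure_concE //; case: (eqVneq (w s) 0) => [->|ws].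
  by rewrite mul0r uconc_ge0.
rewrite (@eq_uconc _ _ (fun h => toC (Num.sqrt (w s))^-1 * chi s h)) //; last first.
  by move=> h hP; rewrite /phi (negPf ws) restrK.
by rewrite uconcZ exprVn sqr_sqrtr // mulrA mulfV // mul1r.
Qed.

Lemma pure_conc_ge0 (J : finType) (Q : pred J) (phi : cfg J -> C) :
  0 <= pure_conc Q phi.
Proof. exact: sqrtr_ge0. Qed.

Lemma ensemble_value_lbound (J : finType) (Q : pred J) (sigma : op R (cfg J)) :
  lbound [set x : R | exists m (pr : 'I_m -> R) (phi : 'I_m -> cfg J -> C),
    ensemble_of sigma pr phi /\ x = \sum_(i < m) pr i * pure_conc Q (phi i)]%classic 0.
Proof.
move=> _ [m [pr [phi [[pr0 _ _ _] ->]]]].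
by apply: sumr_ge0 => i _; rewrite mulr_ge0 // pure_conc_ge0.
Qed.

Lemma conc_le P (Q : pred {x | P x}) (sigma : op R (cfg {x | P x}))
    (S : finType) (chi : S -> cfg I -> C) :
    P x0 -> (forall y, Q y = (val y == x0)) -> trace sigma = 1 ->
    decomposes sigma chi ->
  conc Q sigma <= \sum_s uconc P (chi s).
Proof.
move=> P0 QE tr1 dec.
have [m [pr [phi [ens le]]]] := ensemble_of_decomposition P0 QE tr1 dec.
apply: le_trans le; apply: ge_inf; last by exists m, pr, phi.
by exists 0; apply: ensemble_value_lbound.
Qed.

Lemma conc_ge0 P (Q : pred {x | P x}) (sigma : op R (cfg {x | P x})) :
  0 <= conc Q sigma.
Proof.
rewrite /conc; set E := (X in inf X).
(* For an operator without ensembles, [inf] takes its default value 0. *)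
have [->|/set0P ne] := eqVneq E set0; first by rewrite inf0.
by apply: lb_le_inf => //; apply: ensemble_value_lbound.
Qed.

(** An ensemble becomes a decomposition once its vectors are scaled by the square roots of the
    probabilities. The given [chi] ensures that the infimum is over a nonempty set. *)
Lemma le_conc P (Q : pred {x | P x}) (sigma : op R (cfg {x | P x}))
    (S : finType) (chi : S -> cfg I -> C) (c : R) :
    P x0 -> (forall y, Q y = (val y == x0)) -> trace sigma = 1 ->
    decomposes sigma chi ->
    (forall m (psi : 'I_m -> cfg I -> C), decomposes sigma psi ->
       c <= \sum_i uconc P (psi i)) ->
  c <= conc Q sigma.
Proof.
move=> P0 QE tr1 dec lec; apply: lb_le_inf.
  have [m [pr [phi [ens _]]]] := ensemble_of_decomposition P0 QE tr1 dec.
  by exists (\sum_(i < m) pr i * pure_conc Q (phi i)), m, pr, phi.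
move=> _ [m [pr [phi [[pr0 pr1 nphi sE] ->]]]].
pose psi i h := toC (Num.sqrt (pr i)) * phi i (restr P h).
have := lec m psi; have -> : \sum_i uconc P (psi i) = \sum_(i < m) pr i * pure_conc Q (phi i).
  by apply: eq_bigr => i _; rewrite uconcZ sqr_sqrtr // pure_concE.
apply=> f g fP gP; rewrite sE; apply: eq_bigr => i _.
rewrite /proj /psi rmorphM /= [Num.conj (toC _)]conj_Creal ?complex_real //.
rewrite -{1}(sqr_sqrtr (pr0 i)) rmorphXn /=; ring.
Qed.

End UnnormalizedConcurrence.

(** * Positive operators as sums of rank-one operators *)

Section PositiveOperators.
Variable C : numClosedFieldType.
Local Notation dag M := (map_mx (@Num.conj C) M^T).

(** Polarisation: the form is real at [e i + c *: e j], and the values 1 and 'i of [c] give two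
    relations that determine [B j i] from [B i j]. The spectral theorem becomes applicable. *)
Lemma psd_hermitian n (B : 'M[C]_n) :
  (forall v : 'cV_n, 0 <= (dag v *m B *m v) 0 0) -> dag B = B.
Proof.
move=> B0; apply/matrixP => j i; rewrite dagE.
pose e k : 'cV[C]_n := delta_mx k 0.
have eE k l : (dag (e k) *m B *m e l) 0 0 = B k l.
  have -> : dag (e k) = delta_mx 0 k.
    by apply/matrixP => a b; rewrite !mxE andbC rmorph_nat.
  by rewrite -rowE -colE !mxE.
have Breal k : (B k k)^* = B k k by rewrite geC0_conj // -eE.
have expand c : (dag (e i + c *: e j) *m B *m (e i + c *: e j)) 0 0
    = B i i + c * B i j + (c^* * B j i + c^* * c * B j j).
  have -> : dag (e i + c *: e j) = dag (e i) + c^* *: dag (e j).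
    by apply/matrixP => a b; rewrite !mxE rmorphD rmorphM.
  have addE (X Y : 'M[C]_1) : (X + Y) 0 0 = X 0 0 + Y 0 0 by rewrite mxE.
  have scaleE a (X : 'M[C]_1) : (a *: X) 0 0 = a * X 0 0 by rewrite mxE.
  rewrite !mulmxDl !mulmxDr -!scalemxAl -!scalemxAr -?scalemxAl.
  by rewrite !(addE, scaleE) !eE; ring.
have cross c : (c * B i j)^* + (c^* * B j i)^* = c * B i j + c^* * B j i.
  have := B0 (e i + c *: e j); rewrite expand => /geC0_conj.
  rewrite !rmorphD /= [(c^* * c * B j j)^*]rmorphM /= !Breal.
  have -> : (c^* * c)^* = c^* * c by rewrite rmorphM /= conjCK mulrC.
  move=> /eqP E; apply/eqP; rewrite -subr_eq0; move: E; rewrite -subr_eq0.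
  by congr (_ == 0); ring.
have := cross 'i; have := cross 1.
rewrite !rmorphM /= !conjCK conjC1 conjCi !mul1r => E1 E2.
have {}E2 : - (B i j)^* + (B j i)^* = B i j - B j i.
  apply: (mulfI (neq0Ci C)); rewrite mulrDr mulrBr mulrN.
  by rewrite -mulNr E2 mulNr.
apply: (@mulfI _ 2); first by rewrite pnatr_eq0.
transitivity ((B i j)^* + (B j i)^* - (- (B i j)^* + (B j i)^*)); first by ring.
by rewrite E1 E2; ring.
Qed.

Lemma psd_sum_rank1 n (B : 'M[C]_n) :
    (forall v : 'cV_n, 0 <= (dag v *m B *m v) 0 0) ->
  exists chi : 'I_n -> 'I_n -> C,
    forall i j, B i j = \sum_k chi k i * (chi k j)^*.
Proof.
move=> B0; have hB := psd_hermitian B0.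
have /orthomx_spectralP BE : B \is normalmx by apply/normalmxP; rewrite hB.
have Pu := spectral_unitarymx B.
set P := spectralmx B in BE Pu; set d := spectral_diag B in BE.
rewrite (invmx_unitary Pu) in BE.
have d0 k : 0 <= d 0 k.
  have := B0 (dag (row k P)); rewrite trmxCK -row_mul.
  have -> : P *m B = diag_mx d *m P by rewrite {1}BE !mulmxA (unitarymxP Pu) mul1mx.
  rewrite row_mul row_diag_mx -scalemxAl -rowE -scalemxAl.
  by rewrite mxE -dotmxE (row_unitarymxP _ _) // eqxx mulr1.
exists (fun k i => sqrtC (d 0 k) * (P k i)^*) => i j.
rewrite {1}BE mxE; apply: eq_bigr => k _; rewrite mul_mx_diag mxE dagE.
rewrite rmorphM /= conjCK [(sqrtC _)^*]geC0_conj ?sqrtC_ge0 //.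
by rewrite mulrACA -expr2 sqrtCK; ring.
Qed.

End PositiveOperators.

Lemma psd_decomposition (R : realType) (T : finType) (A : op R T) : psd A ->
  exists chi : 'I_#|T| -> T -> R[i],
    forall a b, A a b = \sum_k chi k a * Num.conj (chi k b).
Proof.
move=> A0; pose B := \matrix_(i < #|T|, j < #|T|) A (enum_val i) (enum_val j).
have [|chi chiE] := @psd_sum_rank1 _ _ B.
  move=> v; have := A0 (fun a => v (enum_rank a) 0); congr (0 <= _).
  rewrite mxE (reindex (@enum_rank T)) /=; last exact/onW_bij/enum_rank_bij.
  rewrite exchange_big; apply: eq_bigr => a _.
  rewrite mxE mulr_suml (reindex (@enum_rank T)) /=; last exact/onW_bij/enum_rank_bij.
  by apply: eq_bigr => b _; rewrite !mxE !enum_rankK.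
exists (fun k a => chi k (enum_rank a)) => a b.
by rewrite -chiE mxE !enum_rankK.
Qed.

(** * Monogamy for a pure vector on a qubit, a second qubit and an arbitrary system *)

Section Monogamy.
Variables (R : realType) (I : finType) (x0 x1 : I).
Local Notation C := R[i].
Local Notation toC := (real_complex R).
Variables (P P1 Pt P2 : pred I).
Hypothesis x01 : x1 != x0.
Hypothesis P2x0 : ~~ P2 x0.
Hypothesis P2x1 : ~~ P2 x1.
Hypothesis P1E : forall x, P1 x = (x == x0) || (x == x1).
Hypothesis PtE : forall x, Pt x = (x == x0) || P2 x.
Hypothesis PE : forall x, P x = [|| x == x0, x == x1 | P2 x].

Local Notation dag M := (map_mx (@Num.conj C) M^T).

Lemma without_P1 : without x0 P1 =1 pred1 x1.
Proof.
move=> x; rewrite withoutE P1E /=; case: eqP => //= ->.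
by rewrite eq_sym (negPf x01).
Qed.

Lemma without_Pt : without x0 Pt =1 P2.
Proof.
move=> x; rewrite withoutE PtE /=; case: eqP => //= ->.
by rewrite (negPf P2x0).
Qed.

Lemma without_P x : without x0 P x = (x == x1) || P2 x.
Proof.
rewrite withoutE PE; case: eqP => //= ->.
by rewrite (negPf P2x0) orbF eq_sym (negPf x01).
Qed.

Lemma gram2_slice Q (chi : cfg I -> C) :
  gram2 (slice x0 Q false chi) (slice x0 Q true chi)
  = (\sum_(c | supp (without x0 Q) c) `|chi (cor (pt x0 false) c)| ^+ 2)
    * (\sum_(c | supp (without x0 Q) c) `|chi (cor (pt x0 true) c)| ^+ 2)
    - `|\sum_(c | supp (without x0 Q) c) chi (cor (pt x0 false) c)
          * Num.conj (chi (cor (pt x0 true) c))| ^+ 2.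
Proof.
rewrite /gram2 sum_slice; congr (_ * _ - _); rewrite [RHS]big_mkcond;
  by apply: eq_bigr => c _; rewrite /slice; case: ifP; rewrite // normr0 expr0n.
Qed.

Lemma eq_sum_supp (V : nmodType) (Q Q' : pred I) (F : cfg I -> V) : Q =1 Q' ->
  \sum_(h | supp Q h) F h = \sum_(h | supp Q' h) F h.
Proof. by move=> QQ; apply: eq_bigl => h; apply: supp_eq. Qed.

Definition idx (b : bool) : 'I_2 := if b then 1 else 0.

Variable chi : cfg I -> C.

(** Amplitudes as a matrix in the values of [x0] and [x1], for a fixed configuration [h] of the
    rest. The value 0 off the support of [P2] allows the family to be indexed by all of [cfg I]. *)
Definition block (h : cfg I) : 'M[C]_2 :=
  if supp P2 h then
    \matrix_(a, b) chi (cor (cor (pt x0 (a == 1)) (pt x1 (b == 1))) h)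
  else 0.

Lemma blockE h a b : supp P2 h ->
  block h (idx a) (idx b) = chi (cor (cor (pt x0 a) (pt x1 b)) h).
Proof. by rewrite /block => ->; rewrite mxE; case: a; case: b. Qed.

Lemma block_out h : ~~ supp P2 h -> block h = 0.
Proof. by rewrite /block => /negPf->. Qed.

Lemma sum_ord2 (V : nmodType) (F : 'I_2 -> V) :
  \sum_k F k = F (idx false) + F (idx true).
Proof.
by rewrite !big_ord_recl big_ord0 addr0; congr (_ + F _); apply/val_inj.
Qed.

Lemma sum_block (F : 'M[C]_2 -> C) : F 0 = 0 ->
  \sum_(j < #|cfg I|) F (block (enum_val j)) = \sum_(h | supp P2 h) F (block h).
Proof.
move=> F0; rewrite [RHS]big_mkcond (reindex (@enum_val _ (cfg I))) /=.
  by apply: eq_bigr => j _; case: ifP => // /negbT/block_out ->.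
exact/onW_bij/enum_val_bij.
Qed.

Lemma supp_P1_pt f : supp P1 f -> f = cor (pt x0 (f x0)) (pt x1 (f x1)).
Proof.
move=> /suppP f1; apply/ffunP => x; rewrite !ffunE.
have [->|nx0] := eqVneq x x0; first by rewrite eq_sym (negPf x01) orbF.
have [->|nx1] := eqVneq x x1; first by [].
by rewrite f1 // P1E negb_or nx0.
Qed.

Lemma single_monogamy :
  exists (chiB : {ffun 'I_#|cfg I| -> bool} -> cfg I -> C)
         (chiC : 'I_2 -> cfg I -> C),
  [/\ forall f g, supp P1 f -> supp P1 g ->
        \sum_s chiB s f * Num.conj (chiB s g)
        = \sum_(h | supp P2 h) chi (cor f h) * Num.conj (chi (cor g h)),
      forall f g, supp Pt f -> supp Pt g ->
        \sum_k chiC k f * Num.conj (chiC k g)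
        = \sum_(h | supp (pred1 x1) h) chi (cor f h) * Num.conj (chi (cor g h)) &
      (\sum_s uconc x0 P1 (chiB s)) ^+ 2 + (\sum_k uconc x0 Pt (chiC k)) ^+ 2
        <= uconc x0 P chi ^+ 2].
Proof.
pose M (j : 'I_#|cfg I|) := block (enum_val j).
have [W [Q [Wiso Qu ineq]]] := concurrence_core M.
(* [chiB] contracts the third system against the rows of [W], [chiC] contracts the qubit [x1]
   against the columns of [Q]; the isometry of [W] and the unitarity of [Q] make them decompose the
   two marginals. *)
pose chiB s f := \sum_j W s j * M j (idx (f x0)) (idx (f x1)).
pose chiC k f := \sum_b Q b k * chi (cor f (pt x1 (b == 1))).
exists chiB, chiC; split.
- move=> f g f1 g1.
  transitivity (\sum_j M j (idx (f x0)) (idx (f x1))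
                 * Num.conj (M j (idx (g x0)) (idx (g x1)))).
    transitivity (\sum_s \sum_j \sum_l (M j (idx (f x0)) (idx (f x1))
        * Num.conj (M l (idx (g x0)) (idx (g x1)))) * (W s j * Num.conj (W s l))).
      apply: eq_bigr => s _; rewrite rmorph_sum mulr_suml; apply: eq_bigr => j _.
      by rewrite mulr_sumr; apply: eq_bigr => l _; rewrite rmorphM /=; ring.
    rewrite exchange_big; apply: eq_bigr => j _ /=; rewrite exchange_big /=.
    rewrite (bigD1 j) //= [X in _ + X]big1 ?addr0 => [|l lj];
      rewrite -mulr_sumr Wiso; first by rewrite eqxx mulr1.
    by rewrite eq_sym (negPf lj) mulr0.
  rewrite (@sum_block (fun X => X (idx (f x0)) (idx (f x1))
     * Num.conj (X (idx (g x0)) (idx (g x1))))); last by rewrite mxE mul0r.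
  by apply: eq_bigr => h h2; rewrite !blockE // -!supp_P1_pt.
- move=> f g ft gt.
  transitivity (\sum_k \sum_b \sum_b' (chi (cor f (pt x1 (b == 1)))
      * Num.conj (chi (cor g (pt x1 (b' == 1))))) * (Q b k * Num.conj (Q b' k))).
    apply: eq_bigr => k _; rewrite rmorph_sum mulr_suml; apply: eq_bigr => b _.
    by rewrite mulr_sumr; apply: eq_bigr => b' _; rewrite rmorphM /=; ring.
  rewrite exchange_big /= (@sum_supp1 _ _ _ x1) //.
  transitivity (\sum_(b : 'I_2) chi (cor f (pt x1 (b == 1)))
      * Num.conj (chi (cor g (pt x1 (b == 1))))); last by rewrite sum_ord2.
  apply: eq_bigr => b _; rewrite exchange_big /=.
  have QE b' : \sum_k Q b k * Num.conj (Q b' k) = (b == b')%:R.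
    have /matrixP/(_ b b') := unitarymxP Qu; rewrite !mxE => <-.
    by apply: eq_bigr => k _; rewrite !mxE.
  rewrite (bigD1 b) //= [X in _ + X]big1 ?addr0 => [|l lj];
    rewrite -mulr_sumr QE; first by rewrite eqxx mulr1.
  by rewrite [b == l]eq_sym (negPf lj) mulr0.
rewrite -lecR rmorphD !rmorphXn !rmorph_sum /=.
(* For two qubits the Gram determinant of the rows of the amplitude matrix is the squared modulus of
   its determinant. *)
have uB s : toC (uconc x0 P1 (chiB s)) = 2 * `|\det (\sum_j W s j *: M j)|.
  set Y := \sum_j _; have YE a b :
      chiB s (cor (pt x0 a) (pt x1 b)) = Y (idx a) (idx b).
    rewrite /chiB !ffunE !eqxx (negPf x01) eq_sym (negPf x01) /= orbF summxE.
    by apply: eq_bigr => j _; rewrite !mxE.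
  rewrite uconcE gram2_slice !(eq_sum_supp _ without_P1).
  rewrite !(@sum_supp1 _ _ _ x1) // !YE det2E /=.
  rewrite -[in RHS](@sqrCK _ `|_|) //; congr (2 * sqrtC _).
  by rewrite !normCK rmorphD rmorphB !rmorphM /= !conjCK; ring.
have uC k : toC (uconc x0 Pt (chiC k)) = 2 * sqrtC
    (gram2 (fun i => (M i *m Q) 0 k) (fun i => (M i *m Q) 1 k)).
  rewrite uconcE; congr (2 * sqrtC _).
  have sE a c : slice x0 Pt a (chiC k) c = (block c *m Q) (idx a) k.
    rewrite /slice (supp_eq _ without_Pt) mxE; case: ifP => [c2|/negbT/block_out->].
      rewrite /chiC; apply: eq_bigr => b _; rewrite mulrC.
      have -> : b = idx (b == 1) by case: b => -[|[|//]] ?; apply/val_inj.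
      rewrite blockE // -!corA [cor c _]corC.
      by congr (chi (cor _ (cor (pt _ _) _)) * _); case: (b == 1).
    by rewrite big1 // => b _; rewrite mxE mul0r.
  have gE (p q : cfg I -> C) :
      gram2 p q = gram2 (fun i : 'I_#|cfg I| => p (enum_val i))
                        (fun i => q (enum_val i)).
    have rE (F : cfg I -> C) : \sum_h F h = \sum_(i < #|cfg I|) F (enum_val i).
      by rewrite (reindex (@enum_val _ (cfg I))) //; apply/onW_bij/enum_val_bij.
    by rewrite /gram2 !rE.
  by rewrite (eq_gram2 (sE false) (sE true)) gE.
have uP : toC (uconc x0 P chi) ^+ 2 = 4 * \det (\sum_i M i *m dag (M i)).
  rewrite uconcE exprMn sqrtCK; have -> : (2 : C) ^+ 2 = 4 by ring.
  congr (_ * _).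
  pose F a a' := \sum_(h | supp P2 h)
    (block h a 0 * Num.conj (block h a' 0) + block h a 1 * Num.conj (block h a' 1)).
  have EF a a' : (\sum_i M i *m dag (M i)) a a' = F a a'.
    rewrite summxE /F -(@sum_block (fun X => X a 0 * Num.conj (X a' 0)
      + X a 1 * Num.conj (X a' 1))); last by rewrite !mxE !mul0r addr0.
    by apply: eq_bigr => j _; rewrite mulmx2E !dagE.
  have GF a a' : \sum_(c | supp (without x0 P) c) chi (cor (pt x0 a) c)
      * Num.conj (chi (cor (pt x0 a') c)) = F (idx a) (idx a').
    rewrite (@sum_supp_split _ _ (pred1 x1) P2 (without x0 P) _ without_P); last first.
      by move=> x /eqP->.
    rewrite (@sum_supp1 _ _ _ x1) // -big_split; apply: eq_bigr => h h2 /=.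
    by rewrite !corA -!blockE.
  rewrite gram2_slice det2E !EF -(GF false false) -(GF true true).
  rewrite -(GF false true) -(GF true false) normCK.
  congr (_ * _ - _ * _); rewrite ?rmorph_sum; apply: eq_bigr => c _; rewrite ?normCK //.
  by rewrite rmorphM /= conjCK mulrC.
rewrite uP (eq_bigr _ (fun s _ => uB s)) (eq_bigr _ (fun k _ => uC k)).
exact: ineq.
Qed.

End Monogamy.

(** * From pure vectors to mixed states *)

Lemma sqrt_sum_sq_le (R : rcfType) m (x y c : 'I_m -> R) (a b : R) :
    (forall i, 0 <= c i) -> (forall i, x i ^+ 2 + y i ^+ 2 <= c i ^+ 2) ->
    0 <= a <= \sum_i x i -> 0 <= b <= \sum_i y i ->
  Num.sqrt (a ^+ 2 + b ^+ 2) <= \sum_i c i.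
Proof.
move=> c0 xyc /andP[a0 ax] /andP[b0 bx]; set N := Num.sqrt _.
have N0 : 0 <= N by apply: sqrtr_ge0.
have NN : N ^+ 2 = a ^+ 2 + b ^+ 2 by rewrite sqr_sqrtr // addr_ge0 ?sqr_ge0.
(* Cauchy-Schwarz against the fixed vector (a, b). Summed over [i], it bounds [N ^+ 2] by [N] times
   the sum of the [c i]. *)
have le i : a * x i + b * y i <= N * c i.
  apply: le_trans (ler_norm _) _; rewrite -ler_sqr ?nnegrE ?mulr_ge0 //.
  rewrite -normrX ger0_norm ?sqr_ge0 // exprMn NN.
  apply: le_trans (ler_wpM2l _ (xyc i)); last by rewrite addr_ge0 ?sqr_ge0.
  rewrite -subr_ge0.
  have -> : (a ^+ 2 + b ^+ 2) * (x i ^+ 2 + y i ^+ 2) - (a * x i + b * y i) ^+ 2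
    = (a * y i - b * x i) ^+ 2 by ring.
  exact: sqr_ge0.
have NS : N * N <= N * \sum_i c i.
  rewrite -expr2 NN mulr_sumr; apply: le_trans (ler_sum _ (fun i _ => le i)).
  by rewrite big_split /= -!mulr_sumr !expr2 lerD // ler_wpM2l.
have [N1|N1] := eqVneq N 0; first by rewrite N1 sumr_ge0.
by move: NS; rewrite ler_pM2l // lt_def N1.
Qed.

(** Each rank-one term of [rho] splits into one vector per configuration of the qubits traced
    out. *)
Lemma state_decomposition (R : realType) (I : finType) (P : pred I)
    (rho : op R (cfg I)) : psd rho ->
  exists (S : finType) (chi : S -> cfg I -> R[i]),
    decomposes (@ptrace R I P rho) chi.
Proof.
move=> /psd_decomposition[chi chiE].
exists ('I_#|cfg I| * cfg I)%type.
exists (fun kc f => if supp (predC P) kc.2 then chi kc.1 (cor f kc.2) else 0).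
move=> f g fP gP; rewrite ptrace_restr //.
rewrite -(pair_big xpredT xpredT (fun k c =>
  (if supp (predC P) c then chi k (cor f c) else 0)
  * Num.conj (if supp (predC P) c then chi k (cor g c) else 0))) /=.
rewrite exchange_big big_mkcond; apply: eq_bigr => c _ /=.
case: ifP => _; last by rewrite big1 // => k _; rewrite mul0r.
by rewrite chiE.
Qed.

(* Each pure component is split by [single_monogamy]; Minkowski's inequality
   for the Euclidean norm of the plane then sums the components. *)
Lemma conc_monogamy (R : realType) (I : finType) (x0 x1 : I)
    (P P1 Pt P2 : pred I) (rho : op R (cfg I))
    (Q : pred {x | P x}) (Q1 : pred {x | P1 x}) (Qt : pred {x | Pt x}) :
    x1 != x0 -> ~~ P2 x0 -> ~~ P2 x1 ->
    (forall x, P1 x = (x == x0) || (x == x1)) ->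
    (forall x, Pt x = (x == x0) || P2 x) ->
    (forall x, P x = [|| x == x0, x == x1 | P2 x]) ->
    (forall y, Q y = (val y == x0)) -> (forall y, Q1 y = (val y == x0)) ->
    (forall y, Qt y = (val y == x0)) ->
    is_state rho ->
  conc Q1 (@ptrace R I P1 rho) ^+ 2 + conc Qt (@ptrace R I Pt rho) ^+ 2
    <= conc Q (@ptrace R I P rho) ^+ 2.
Proof.
move=> x01 P20 P21 P1E PtE PE QE Q1E QtE [psdr tr1].
set a := conc Q1 _; set b := conc Qt _; set c := conc Q _.
have tr T : trace (@ptrace R I T rho) = 1 by rewrite trace_ptrace.
have P0 : P x0 by rewrite PE eqxx.
have P10 : P1 x0 by rewrite P1E eqxx.
have Pt0 : Pt x0 by rewrite PtE eqxx.
(* In this form the claim is a lower bound on [c] itself, which [le_conc] allows to test on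
   decompositions. *)
suff le : Num.sqrt (a ^+ 2 + b ^+ 2) <= c.
  rewrite -[leLHS]sqr_sqrtr ?addr_ge0 ?sqr_ge0 //.
  by rewrite ler_sqr ?nnegrE ?sqrtr_ge0 // conc_ge0.
have [S [chi0 dec0]] := state_decomposition P psdr.
apply: (le_conc P0 QE (tr P) dec0) => m psi dec.
have sm i : exists BC : ({ffun 'I_#|cfg I| -> bool} -> cfg I -> R[i])
                        * ('I_2 -> cfg I -> R[i]),
  [/\ forall f g, supp P1 f -> supp P1 g ->
        \sum_s BC.1 s f * Num.conj (BC.1 s g)
        = \sum_(h | supp P2 h) psi i (cor f h) * Num.conj (psi i (cor g h)),
      forall f g, supp Pt f -> supp Pt g ->
        \sum_k BC.2 k f * Num.conj (BC.2 k g) = \sum_(h | supp (pred1 x1) h)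
          psi i (cor f h) * Num.conj (psi i (cor g h)) &
      (\sum_s uconc x0 P1 (BC.1 s)) ^+ 2 + (\sum_k uconc x0 Pt (BC.2 k)) ^+ 2
        <= uconc x0 P (psi i) ^+ 2].
  have [B [B' H]] := single_monogamy x01 P20 P21 P1E PtE PE (psi i).
  by exists (B, B').
have [BC BCE] := fin_all_exists sm.
have disj1 x : P1 x -> ~~ P2 x by rewrite P1E => /orP[] /eqP->.
have disjt x : Pt x -> ~~ pred1 x1 x.
  rewrite PtE => /orP[/eqP->|]; first by rewrite /= eq_sym.
  by apply: contraTN => /eqP->.
have PE1 x : P x = P1 x || P2 x by rewrite PE P1E orbA.
have PEt x : P x = Pt x || pred1 x1 x by rewrite PE PtE /= orbAC orbA orbAC.
have sub1 f h : supp P1 f -> supp P2 h -> supp P (cor f h).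
  move=> f1 h2; apply: supp_cor; [apply: supp_sub f1|apply: supp_sub h2] => x;
  by rewrite PE1 => ->; rewrite ?orbT.
have subt f h : supp Pt f -> supp (pred1 x1) h -> supp P (cor f h).
  move=> f1 h2; apply: supp_cor; [apply: supp_sub f1|apply: supp_sub h2] => x;
  by rewrite PEt => ->; rewrite ?orbT.
have decB : decomposes (@ptrace R I P1 rho)
    (fun js : 'I_m * {ffun 'I_#|cfg I| -> bool} => (BC js.1).1 js.2).
  move=> f g f1 g1; rewrite (ptrace_tower rho PE1 disj1) //.
  rewrite -(pair_big xpredT xpredT (fun i s =>
    (BC i).1 s f * Num.conj ((BC i).1 s g))) /=.
  rewrite (eq_bigr (fun h => \sum_i psi i (cor f h) * Num.conj (psi i (cor g h)))).
    by rewrite exchange_big; apply: eq_bigr => i _; case: (BCE i) => -> .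
  by move=> h h2; rewrite dec ?sub1.
have decC : decomposes (@ptrace R I Pt rho)
    (fun ik : 'I_m * 'I_2 => (BC ik.1).2 ik.2).
  move=> f g f1 g1; rewrite (ptrace_tower rho PEt disjt) //.
  rewrite -(pair_big xpredT xpredT (fun i k =>
    (BC i).2 k f * Num.conj ((BC i).2 k g))) /=.
  rewrite (eq_bigr (fun h => \sum_i psi i (cor f h) * Num.conj (psi i (cor g h)))).
    by rewrite exchange_big; apply: eq_bigr => i _; case: (BCE i) => _ -> .
  by move=> h h2; rewrite dec ?subt.
have leB := conc_le P10 Q1E (tr P1) decB.
have leC := conc_le Pt0 QtE (tr Pt) decC.
rewrite -(pair_big xpredT xpredT (fun i s => uconc x0 P1 ((BC i).1 s))) /= in leB.
rewrite -(pair_big xpredT xpredT (fun i k => uconc x0 Pt ((BC i).2 k))) /= in leC.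
apply: (sqrt_sum_sq_le (x := fun i => \sum_s uconc x0 P1 ((BC i).1 s))
  (y := fun i => \sum_k uconc x0 Pt ((BC i).2 k))).
- by move=> i; apply: uconc_ge0.
- by move=> i; case: (BCE i).
- by rewrite leB conc_ge0.
by rewrite leC conc_ge0.
Qed.

(** * Inequalities for real powers, and iteration along a chain *)

Section PowerInequalities.
Variable R : realType.
Implicit Types a b c d k p t u v x z : R.

(** Young's inequality for z^x and 1, with conjugate exponents 1/x and 1/(1-x). *)
Lemma powR_le_tangent z x : 0 < z -> 0 <= x <= 1 -> z `^ x <= 1 + x * (z - 1).
Proof.
move=> z0 /andP[x0 x1]; have zge := ltW z0.
have [->|xn0] := eqVneq x 0; first by rewrite powRr0 mul0r addr0.
have [->|xn1] := eqVneq x 1; first by rewrite powRr1 // mul1r addrC subrK.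
have xp : 0 < x by rewrite lt_def xn0.
have x1p : 0 < 1 - x by rewrite subr_gt0 lt_def eq_sym xn1.
have := @conjugate_powR R (z `^ x) 1 x^-1 (1 - x)^-1 (powR_ge0 _ _) ler01.
rewrite !invr_gt0 !invrK xp x1p mulr1 -powRrM mulfV // powRr1 // powR1.
move=> H; apply: le_trans (H _ _ _) _ => //; first by rewrite addrC subrK.
by rewrite le_eqVlt; apply/orP; left; apply/eqP; ring.
Qed.

(** Both points are compared with the tangent at their mean [m], where the linear terms cancel. *)
Lemma powR_concave x a b c : 0 <= x <= 1 -> 0 < a -> 0 < b -> 0 <= c <= 1 ->
  c * a `^ x + (1 - c) * b `^ x <= (c * a + (1 - c) * b) `^ x.
Proof.
move=> hx a0 b0 /andP[c0 c1]; set m := c * a + (1 - c) * b.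
have m0 : 0 < m.
  rewrite /m; have [->|cn0] := eqVneq c 0; first by lra.
  have ca : 0 < c * a by rewrite mulr_gt0 // lt_def cn0.
  have cb : 0 <= (1 - c) * b by rewrite mulr_ge0 ?subr_ge0 // ltW.
  lra.
have scale y : 0 < y -> y `^ x = m `^ x * (y / m) `^ x.
  move=> y0; rewrite -powRM ?divr_ge0 ?ltW //.
  by rewrite mulrC divfK // gt_eqF.
have tang y : 0 < y -> (y / m) `^ x <= 1 + x * (y / m - 1).
  by move=> y0; apply: powR_le_tangent; rewrite ?divr_gt0.
rewrite (scale a a0) (scale b b0) mulrCA [(1 - c) * _]mulrCA -mulrDr.
rewrite -[leRHS]mulr1 ler_wpM2l ?powR_ge0 //.
apply: (@le_trans _ _ (c * (1 + x * (a / m - 1)) + (1 - c) * (1 + x * (b / m - 1)))).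
  by rewrite lerD // ler_wpM2l ?subr_ge0 // tang.
rewrite le_eqVlt; apply/orP; left; apply/eqP.
have mE : c * (a / m) + (1 - c) * (b / m) = 1.
  by rewrite !mulrA -mulrDl -/m divff // gt_eqF.
by transitivity (1 + x * (c * (a / m) + (1 - c) * (b / m) - 1));
  [ring | rewrite mE subrr mulr0 addr0].
Qed.

(** The inner points [b] and [c] are convex combinations of [a] and [d] with exchanged weights. *)
Lemma powR_majorization x a b c d : 0 <= x <= 1 ->
  0 < a -> a <= b -> a <= c -> a + d = b + c ->
  a `^ x + d `^ x <= b `^ x + c `^ x.
Proof.
move=> hx a0 ab ac adbc.
have [da|da] := eqVneq d a.
  have -> : b = a by lra.
  have -> : c = a by lra.
  by rewrite da.
have da0 : 0 < d - a by rewrite lt_def subr_eq0 da /=; lra.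
pose s := (d - b) / (d - a).
have hs : 0 <= s <= 1.
  by rewrite divr_ge0 ?ler_pdivrMr ?mul1r //; lra.
have hs' : 0 <= 1 - s <= 1 by lra.
have d0 : 0 < d by lra.
have dan0 : d - a != 0 by rewrite gt_eqF.
have bE : s * a + (1 - s) * d = b by rewrite /s; field.
have cE : (1 - s) * a + (1 - (1 - s)) * d = c.
  have -> : c = a + d - b by lra.
  by rewrite /s; field.
have := powR_concave hx a0 d0 hs; rewrite bE.
have := powR_concave hx a0 d0 hs'; rewrite cE.
move: (a `^ x) (b `^ x) (c `^ x) (d `^ x) => A B C' D.
lra.
Qed.

Lemma powR_ge1 a x : 1 <= a -> 0 <= x -> 1 <= a `^ x.
Proof. by move=> a1 x0; have := ler_powR a1 x0; rewrite powRr0. Qed.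

Lemma powR4_le2 x : 0 <= x <= 1 / 2 -> 4 `^ x <= 2 :> R.
Proof.
move=> hx; have -> : (4 : R) = 2 `^ 2 by rewrite (powR_mulrn 2) //; ring.
rewrite -powRrM; apply: (@le_trans _ _ (2 `^ 1)); last by rewrite powRr1.
by apply: ler_powR; lra.
Qed.

(** The claim is multiplied by 2^x because p >= 1/2 then reads 2^x p^x >= 1. It remains to show that
    2^x ((1+t)^x k^x - (1+k)^x t^x) >= k^x - t^x, which is the sum of [maj] and [mid]. *)
Lemma powR_ratio_monotone k t p x : 1 <= k -> k <= t -> 1 / 2 <= p <= 1 ->
    0 <= x <= 1 / 2 ->
  ((1 + k) `^ x - p `^ x) * t `^ x <= ((1 + t) `^ x - p `^ x) * k `^ x.
Proof.
move=> k1 kt hp hx; have hx1 : 0 <= x <= 1 by lra.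
have tk : k * 1 <= k * t by rewrite ler_pM2l; lra.
have kt1 : 1 * t <= k * t by rewrite ler_pM2r; lra.
have ktx : k `^ x <= t `^ x by apply: ge0_ler_powR; rewrite ?nnegrE; lra.
have maj : (2 * k + 2 * t) `^ x + (2 * t + 2 * (k * t)) `^ x
    <= (4 * t) `^ x + (2 * k + 2 * (k * t)) `^ x.
  by apply: powR_majorization => //; lra.
(* Concavity at the midpoint of [k] and [t], scaled by 4^x; the bound x <= 1/2 enters through 4^x <=
   2. *)
have mid : (4 * t) `^ x + k `^ x <= (2 * k + 2 * t) `^ x + t `^ x.
  have := @powR_concave x k t (1 / 2) hx1.
  have -> : 1 / 2 * k + (1 - 1 / 2) * t = (2 * k + 2 * t) / 4 by field.
  move=> /(_ _ _ _) H; have {H} : 1 / 2 * k `^ x + (1 - 1 / 2) * t `^ x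
      <= ((2 * k + 2 * t) / 4) `^ x by apply: H; lra.
  have -> : (2 * k + 2 * t) `^ x = 4 `^ x * ((2 * k + 2 * t) / 4) `^ x.
    by rewrite -powRM; [congr (_ `^ _); field | lra | lra].
  rewrite [(4 * t) `^ x]powRM; [|lra|lra].
  move=> conc; have F2 := powR4_le2 hx.
  have F0 : 0 <= 4 `^ x :> R by apply: powR_ge0.
  have FG := ler_wpM2l F0 conc.
  have : 0 <= (2 - 4 `^ x) * (t `^ x - k `^ x) by rewrite mulr_ge0 ?subr_ge0.
  lra.
have T0 : 0 < 2 `^ x :> R by apply: powR_gt0; lra.
have Tp : 1 <= 2 `^ x * p `^ x.
  by rewrite -powRM; [apply: powR_ge1 | | ]; lra.
rewrite -(ler_pM2l T0) -subr_ge0.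
have E1 : (2 * t + 2 * (k * t)) `^ x = 2 `^ x * (1 + k) `^ x * t `^ x.
  by rewrite -!powRM; try lra; congr (_ `^ _); ring.
have E2 : (2 * k + 2 * (k * t)) `^ x = 2 `^ x * (1 + t) `^ x * k `^ x.
  by rewrite -!powRM; try lra; congr (_ `^ _); ring.
rewrite {}E1 {}E2 in maj.
set D := (X in 0 <= X).
have -> : D = 2 `^ x * (1 + t) `^ x * k `^ x - 2 `^ x * (1 + k) `^ x * t `^ x
   + 2 `^ x * p `^ x * (t `^ x - k `^ x) by rewrite /D; ring.
have : 0 <= (2 `^ x * p `^ x - 1) * (t `^ x - k `^ x).
  by rewrite mulr_ge0 ?subr_ge0.
lra.
Qed.

Definition weight k p x : R := ((1 + k) `^ x - p `^ x) / k `^ x.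

Lemma weight_ge0 k p x : 1 <= k -> 1 / 2 <= p <= 1 -> 0 <= x <= 1 / 2 ->
  0 <= weight k p x.
Proof.
move=> k1 hp hx; rewrite divr_ge0 ?powR_ge0 // subr_ge0.
by apply: ge0_ler_powR; rewrite ?nnegrE; lra.
Qed.

(** For x > 0 this is the limit of the ratio monotonicity as [t] grows, the ratio tending to 1; it
    settles the case [u = 0] below. The proof is a majorization with end points 2 and 2k + 2. *)
Lemma weight_le1 k p x : 1 <= k -> 1 / 2 <= p <= 1 -> 0 <= x <= 1 / 2 ->
  weight k p x <= 1.
Proof.
move=> k1 hp hx; have hx1 : 0 <= x <= 1 by lra.
have k0 : 0 < k `^ x by apply: powR_gt0; lra.
rewrite ler_pdivrMr // mul1r.
have T0 : 0 < 2 `^ x :> R by apply: powR_gt0; lra.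
have T1 : 1 <= 2 `^ x :> R by apply: powR_ge1; lra.
have Tp : 1 <= 2 `^ x * p `^ x.
  by rewrite -powRM; [apply: powR_ge1 | | ]; lra.
have := @powR_majorization x 2 4 (2 * k) (2 * k + 2) hx1.
move=> H; have {H} : 2 `^ x + (2 * k + 2) `^ x <= 4 `^ x + (2 * k) `^ x.
  by apply: H; lra.
have -> : (2 * k + 2) `^ x = 2 `^ x * (1 + k) `^ x.
  by rewrite -powRM; [congr (_ `^ _); ring | lra | lra].
rewrite [(2 * k) `^ x]powRM; [|lra|lra].
have := powR4_le2 hx; move=> F2 H.
rewrite -(ler_pM2l T0); lra.
Qed.

Lemma powR_add_ge_weighted k p x u v : 1 <= k -> 1 / 2 <= p <= 1 ->
    0 <= x <= 1 / 2 -> 0 <= u -> 0 <= v -> k * u <= v ->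
  p `^ x * u `^ x + weight k p x * v `^ x <= (u + v) `^ x.
Proof.
move=> k1 hp hx u0 v0 kuv.
(* Exponent zero is set apart because the power of 0 is then 1, not 0. *)
have [->|x0] := eqVneq x 0.
  by rewrite /weight !powRr0 subrr !mul0r addr0 mulr1.
have [->|un0] := eqVneq u 0.
  rewrite powR0 // mulr0 !add0r -[leRHS]mul1r ler_wpM2r ?powR_ge0 //.
  exact: weight_le1.
have up : 0 < u by rewrite lt_def un0.
have k0 : 0 < k `^ x by apply: powR_gt0; lra.
have [t vE] : exists t, v = u * t by exists (v / u); rewrite mulrC divfK.
have tk : k <= t by move: kuv; rewrite vE mulrC ler_pM2l.
have -> : u + v = u * (1 + t) by rewrite vE; ring.
have t0 : 0 <= t by lra.
have t1 : 0 <= 1 + t by lra.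
rewrite vE !powRM //.
rewrite [p `^ x * _]mulrC mulrCA -mulrDr ler_wpM2l ?powR_ge0 //.
have := powR_ratio_monotone k1 tk hp hx.
rewrite -ler_pdivrMr // mulrAC -/(weight k p x).
lra.
Qed.

(** Each r-th power is the base times its (r-1)-th power, and the latter is monotone. *)
Lemma powR_superadditive u v r : 0 <= u -> 0 <= v -> 1 <= r ->
  u `^ r + v `^ r <= (u + v) `^ r.
Proof.
move=> u0 v0 r1; have r0 : 0 < r by lra.
rewrite -(mulr_powRB1 u0 r0) -(mulr_powRB1 v0 r0).
rewrite -(mulr_powRB1 (addr_ge0 u0 v0) r0) mulrDl.
by apply: lerD; apply: ler_wpM2l => //; apply: ge0_ler_powR; rewrite ?nnegrE; lra.
Qed.

Lemma monogamy_powR (a b c r : R) : 0 <= a -> 0 <= b -> 0 <= c -> 2 <= r ->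
  a ^+ 2 + b ^+ 2 <= c ^+ 2 -> a `^ r + b `^ r <= c `^ r.
Proof.
move=> a0 b0 c0 r2 abc.
have E y : 0 <= y -> y `^ r = (y ^+ 2) `^ (r / 2).
  by move=> y0; rewrite -powR_mulrn // -powRrM; congr (_ `^ _); field.
rewrite !E //; apply: le_trans (powR_superadditive _ _ _) _; rewrite ?sqr_ge0 //; first by lra.
by apply: ge0_ler_powR; rewrite ?nnegrE ?addr_ge0 ?sqr_ge0 //; lra.
Qed.

Lemma exponent_ratio_bounds r a : 2 <= r -> 0 <= a <= r / 2 ->
  0 <= a / r <= 1 / 2.
Proof.
move=> r2 ha; have r0 : 0 < r by lra.
by apply/andP; split; [apply: divr_ge0; lra | rewrite ler_pdivrMr //; lra].
Qed.

Lemma powR_exponent_ratio y a r : 2 <= r -> y `^ a = (y `^ r) `^ (a / r).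
Proof. by move=> r2; rewrite -powRrM mulrC divfK // gt_eqF //; lra. Qed.

Lemma monogamy_step k p r alpha a b c : 1 <= k -> 1 / 2 <= p <= 1 -> 2 <= r ->
    0 <= alpha <= r / 2 -> 0 <= a -> 0 <= b -> 0 <= c ->
    a ^+ 2 + b ^+ 2 <= c ^+ 2 -> k * a `^ r <= b `^ r ->
  p `^ (alpha / r) * a `^ alpha + weight k p (alpha / r) * b `^ alpha <= c `^ alpha.
Proof.
move=> k1 hp r2 ha a0 b0 c0 abc kab; have hx := exponent_ratio_bounds r2 ha.
rewrite !(powR_exponent_ratio _ alpha r2).
apply: le_trans (powR_add_ge_weighted k1 hp hx _ _ kab) _; rewrite ?powR_ge0 //.
apply: ge0_ler_powR; rewrite ?nnegrE ?addr_ge0 ?powR_ge0 ?monogamy_powR //.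
by case/andP: hx.
Qed.

(** [T] stands for powers of tail concurrences and [A] for those of pairs. Each step replaces the
    last tail by its lower bound, at the cost of a factor [l]; for [m = 1] nothing has been split
    off. *)
Lemma weighted_chain_up (T A : nat -> R) (q l : R) m : 0 <= l -> (1 <= m)%N ->
    (forall i, (2 <= i <= m)%N -> q * A i + l * T i <= T i.-1) ->
  q * (\sum_(2 <= i < m.+1) l ^+ (i - 2) * A i) + l ^+ (m - 1) * T m <= T 1%N.
Proof.
move=> l0; elim: m => // -[_ _ _|m IHm _ H].
  by rewrite big_geq // mulr0 add0r subnn mul1r.
apply: le_trans (IHm isT _); last by move=> i hi; apply: H; lia.
have := H m.+2; rewrite leqnn /= => /(_ isT) Hm.
rewrite big_nat_recr //= mulrDr -addrA lerD2l.
have -> : (m.+2 - 2 = m)%N by lia.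
have -> : (m.+2 - 1 = m.+1)%N by lia.
have -> : (m.+1 - 1 = m)%N by lia.
have -> : q * (l ^+ m * A m.+2) + l ^+ m.+1 * T m.+2
    = l ^+ m * (q * A m.+2 + l * T m.+2) by rewrite exprS; ring.
by rewrite ler_wpM2l ?exprn_ge0.
Qed.

Lemma weighted_chain_down (T A : nat -> R) (q l : R) (m d : nat) : 0 <= q ->
    (forall j, (m + 1 <= j <= m + d)%N -> l * A j + q * T j <= T j.-1) ->
  l * (\sum_(m.+1 <= j < (m + d).+1) q ^+ (j - m - 1) * A j) + q ^+ d * T (m + d)%N
    <= T m.
Proof.
move=> q0; elim: d => [_|d IHd H].
  by rewrite addn0 big_geq // mulr0 add0r mul1r.
apply: le_trans (IHd _); last by move=> i hi; apply: H; lia.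
have Hm : l * A (m + d).+1 + q * T (m + d).+1 <= T (m + d)%N.
  by apply: (H (m + d).+1); lia.
rewrite addnS big_nat_recr /=; last by lia.
rewrite mulrDr -addrA lerD2l.
have -> : ((m + d).+1 - m - 1 = d)%N by lia.
have -> : l * (q ^+ d * A (m + d).+1) + q ^+ d.+1 * T (m + d).+1
    = q ^+ d * (l * A (m + d).+1 + q * T (m + d).+1) by rewrite exprS; ring.
by rewrite ler_wpM2l ?exprn_ge0.
Qed.

End PowerInequalities.

(** * The chain of tails of an n-qubit state, and the weighted monogamy inequalities *)

Section QubitChain.
Variables (R : realType) (n : nat) (rho : op R (cfg 'I_n)).
Hypothesis state_rho : is_state rho.

Lemma tail_monogamy j : (2 <= j <= n - 1)%N ->
  C_A1A rho j ^+ 2 + C_A1tail rho j ^+ 2 <= C_A1tail rho j.-1 ^+ 2.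
Proof.
move=> hj; have n0 : (0 < n)%N by lia.
have jn : (j.-1 < n)%N by lia.
(* Ordinals start at 0: the qubit A_j is [j.-1], and the qubits after it are those of index at least
   [j]. *)
apply: (@conc_monogamy R 'I_n (Ordinal n0) (Ordinal jn) _ _ _
  [pred x : 'I_n | (j <= x)%N]) => //=; rewrite -?ltnNge; try lia.
- by rewrite -val_eqE /=; lia.
- by move=> x; rewrite -!val_eqE /sysA1tail /=; lia.
Qed.

Lemma last_tail : C_A1tail rho (n - 1) = C_A1A rho n.
Proof.
rewrite /C_A1tail /C_A1A; suff -> : @sysA1tail n (n - 1) = @sysA1Ai n n by [].
apply/boolp.funext => x; rewrite /sysA1tail /sysA1Ai /=.
by have := ltn_ord x; lia.
Qed.

Lemma C_A1A_ge0 i : 0 <= C_A1A rho i.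
Proof. exact: conc_ge0. Qed.

Lemma C_A1tail_ge0 i : 0 <= C_A1tail rho i.
Proof. exact: conc_ge0. Qed.

End QubitChain.

Theorem theorem2 (R : realType) (n : nat) (rho : op R (cfg 'I_n))
    (k p r alpha : R) :
  is_state rho -> 1 <= k -> 1 / 2 <= p <= 1 -> 2 <= r -> 0 <= alpha <= r / 2 ->
  let l := ((1 + k) `^ (alpha / r) - p `^ (alpha / r)) / k `^ (alpha / r) in
  (* (1) *)
  (forall m : nat, (4 <= n)%N -> (2 <= m <= n - 2)%N ->
     (forall i : nat, (2 <= i <= m)%N ->
        k * C_A1A rho i `^ r <= C_A1tail rho i `^ r) ->
     (forall j : nat, (m + 1 <= j <= n - 1)%N ->
        C_A1A rho j `^ r >= k * C_A1tail rho j `^ r) ->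
     C_A1tail rho 1 `^ alpha >=
       p `^ (alpha / r) * (\sum_(2 <= i < m.+1) l ^+ (i - 2) * C_A1A rho i `^ alpha)
       + l ^+ m * (\sum_(m.+1 <= j < n)
                     p `^ ((j - m - 1)%:R * alpha / r) * C_A1A rho j `^ alpha)
       + l ^+ (m - 1) * p `^ ((n - m - 1)%:R * alpha / r) * C_A1A rho n `^ alpha)
  /\
  (* (2) *)
  ((3 <= n)%N ->
     (forall i : nat, (2 <= i <= n - 1)%N ->
        k * C_A1A rho i `^ r <= C_A1tail rho i `^ r) ->
     C_A1tail rho 1 `^ alpha >=
       p `^ (alpha / r) * (\sum_(2 <= i < n) l ^+ (i - 2) * C_A1A rho i `^ alpha)
       + l ^+ (n - 2) * C_A1A rho n `^ alpha)
  /\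
  (* (3) *)
  ((3 <= n)%N ->
     (forall j : nat, (2 <= j <= n - 1)%N ->
        C_A1A rho j `^ r >= k * C_A1tail rho j `^ r) ->
     C_A1tail rho 1 `^ alpha >=
       l * (\sum_(2 <= j < n) p `^ ((j - 2)%:R * alpha / r) * C_A1A rho j `^ alpha)
       + p `^ ((n - 2)%:R * alpha / r) * C_A1A rho n `^ alpha).
Proof.
move=> st k1 hp r2 ha l; set q := p `^ (alpha / r).
pose A i := C_A1A rho i `^ alpha; pose T j := C_A1tail rho j `^ alpha.
have l0 : 0 <= l by apply: weight_ge0 => //; apply: exponent_ratio_bounds.
have q0 : 0 <= q by apply: powR_ge0.
have qE i : p `^ (i%:R * alpha / r) = q ^+ i.
  by rewrite -mulrA mulrC powRrM powR_mulrn.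
have up i : (2 <= i <= n - 1)%N -> k * C_A1A rho i `^ r <= C_A1tail rho i `^ r ->
    q * A i + l * T i <= T i.-1.
  move=> hi kle; apply: (monogamy_step k1 hp r2 ha) kle;
    by rewrite ?C_A1A_ge0 ?C_A1tail_ge0 ?tail_monogamy.
(* Monogamy is symmetric in the pair and the tail, so the dominant one may take the weight [l] in
   either case. *)
have down j : (2 <= j <= n - 1)%N -> k * C_A1tail rho j `^ r <= C_A1A rho j `^ r ->
    l * A j + q * T j <= T j.-1.
  move=> hj kle; rewrite addrC; apply: (monogamy_step k1 hp r2 ha) kle;
    by rewrite ?C_A1A_ge0 ?C_A1tail_ge0 // addrC tail_monogamy.
have An : A n = T (n - 1)%N by rewrite /T last_tail.
split; [|split].
- move=> m n4 hm lo hi.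
  have U : q * (\sum_(2 <= i < m.+1) l ^+ (i - 2) * A i) + l ^+ (m - 1) * T m <= T 1%N.
    by apply: weighted_chain_up => // [|i hi']; [lia | apply: up; [lia | apply: lo]].
  have D := @weighted_chain_down R T A q l m (n - 1 - m) q0.
  have {D} : l * (\sum_(m.+1 <= j < n) q ^+ (j - m - 1) * A j)
      + q ^+ (n - m - 1) * A n <= T m.
    rewrite An; have -> : (n - m - 1 = n - 1 - m)%N by lia.
    have nE : (m + (n - 1 - m) = n - 1)%N by lia.
    have nE' : ((n - 1).+1 = n)%N by lia.
    by move: D; rewrite nE nE'; apply=> j hj; apply: down; [lia | apply: hi; lia].
  (* The bound on [T m] is inserted at the end of the chain [U], where [T m] has coefficient
     [l ^+ (m - 1)]; its own factor [l] raises the exponent to [m], except on the last term. *)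
  move=> /(ler_wpM2l (exprn_ge0 (m - 1) l0)) D.
  apply: le_trans U; rewrite -addrA lerD2l; apply: le_trans D.
  have -> : l ^+ m = l ^+ (m - 1) * l by rewrite -exprSr; congr (_ ^+ _); lia.
  by rewrite qE; under eq_bigr do rewrite qE; rewrite mulrDr !mulrA.
- move=> n3 lo; rewrite -/(A n) An.
  have := @weighted_chain_up R T A q l (n - 1) l0.
  have -> : ((n - 1).+1 = n)%N by lia.
  have -> : (n - 1 - 1 = n - 2)%N by lia.
  apply; first by lia.
  by move=> i hi; apply: up => //; apply: lo.
- move=> n3 hi; rewrite -/(A n) An qE; under eq_bigr do rewrite qE.
  have := @weighted_chain_down R T A q l 1 (n - 2) q0.
  have -> : (1 + (n - 2) = n - 1)%N by lia.
  have -> : ((n - 1).+1 = n)%N by lia.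
  move=> D; apply: le_trans (D _); last first.
    by move=> j hj; apply: down; [lia | apply: hi; lia].
  rewrite lerD2r ler_wpM2l // ler_sum_nat // => j hj.
  by rewrite -subnDA.
Qed.
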